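(* Let $\varepsilon>0$ be fixed and let $p=p(n)$ satisfy $p=\omega(\log n/n)$ (and $p\le 1$). Let $G=G_{n,p}$ and let $f:E(G)\to\{1,\ldots,e(G)\}$ be a uniformly random edge ordering of $G$ (chosen after exposing $G$). Then, with high probability, the longest $f$-increasing trail in $G$ has length at least $(1-\varepsilon)enp$.
   Context: $G_{n,p}$ is the Erdős–Rényi random graph on $n$ vertices in which each pair of vertices is an edge independently with probability $p$. A trail is a sequence of vertices $v_1,\ldots,v_t$ with $v_iv_{i+1}$ an edge for all $i$ and no edge used more than once; its length is its number of edges. Given a bijection $f:E(G)\to\{1,\ldots,e(G)\}$, a trail with consecutive edges $e_1,\ldots,e_k$ is $f$-increasing if $f(e_1)<f(e_2)<\cdots<f(e_k)$. ''With high probability'' means with probability tending to $1$ as $n\to\infty$; $e$ denotes Euler's number. *)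

(* Defs.v *)
From mathcomp Require Import all_boot all_order all_algebra.
From mathcomp Require Import all_classical all_reals all_analysis.

Set Implicit Arguments.
Unset Strict Implicit.
Unset Printing Implicit Defensive.

Import Order.TTheory GRing.Theory Num.Theory.

Local Open Scope nat_scope.

Definition pairs n : {set {set 'I_n}} := [set e : {set 'I_n} | #|e| == 2].

(* A simple graph on 'I_n is given by its edge set E \subset pairs n. *)
Definition edge n (E : {set {set 'I_n}}) := {e : {set 'I_n} | e \in E}.

(* Ranks run over {0, ..., e(G) - 1} instead of {1, ..., e(G)}: only their
   relative order is ever used. *)
Definition edge_orderings n (E : {set {set 'I_n}}) :
    {set {ffun edge E -> 'I_#|E|}} :=
  [set f : {ffun edge E -> 'I_#|E|} |
    injectiveb f && [forall k, k \in codom f]].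

Definition walk_edges n (v : seq 'I_n) : seq {set 'I_n} :=
  if v is x :: s then pairmap (fun y z => [set y; z]) x s else [::].

Definition is_trail n (E : {set {set 'I_n}}) (v : seq 'I_n) : bool :=
  all (fun e => e \in E) (walk_edges v) && uniq (walk_edges v).

(* [pmap insub] only retypes the edges of [v] as elements of [edge E]: no edge
   is dropped, since those of a trail all lie in E. *)
Definition increasing_trail n (E : {set {set 'I_n}})
    (f : {ffun edge E -> 'I_#|E|}) (v : seq 'I_n) : bool :=
  is_trail E v &&
  sorted (fun e1 e2 : edge E => f e1 < f e2) (pmap insub (walk_edges v)).

(* A trail of length k visits k.+1 vertices; its edges being distinct,
   k <= #|E|, so the maximum ranges over all increasing trails. *)
Definition longest_increasing_trail n (E : {set {set 'I_n}})
    (f : {ffun edge E -> 'I_#|E|}) : nat :=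
  \max_(k < #|E|.+1 | [exists v : k.+1.-tuple 'I_n, increasing_trail f v]) k.

Local Open Scope ring_scope.

Definition gnp_mass (R : realType) n (p : R) (E : {set {set 'I_n}}) : R :=
  \prod_(e in pairs n) (if e \in E then p else 1 - p).

(* The probability of the event A when the edge set E is that of G_{n,p} and,
   given E, the ordering f is uniform on [edge_orderings E]. *)
Definition gnp_ordering_prob (R : realType) n (p : R)
    (A : forall E : {set {set 'I_n}}, pred {ffun edge E -> 'I_#|E|}) : R :=
  \sum_(E in powerset (pairs n))
    gnp_mass p E *
    (#|[set f in edge_orderings E | A E f]|%:R / #|edge_orderings E|%:R).

(* Main.v *)
Require Import Defs.
From mathcomp Require Import all_boot all_order all_algebra.
From mathcomp Require Import all_classical all_reals all_analysis.
From mathcomp Require Import ring lra zify.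

(** Given its number m of edges, the randomly ordered random graph is a uniform
sequence of m distinct pairs, revealed one at a time.  If w ends an increasing
trail of length k and the next edge is {w, u}, then u ends one of length k + 1.
Cut the sequence into blocks of eta n / 2 edges: as long as few vertices are tips
of trails of length k + 1, each block adds at least (1 - o(1)) eta |tips k| of
them, so after r blocks at least beta n C(r, k) x^k vertices are tips of trails of
length k, with x close to eta.  By Stirling's formula C(K, l) x^l >= 1 for some
l = (1 - o(1)) e eta K; hence K blocks turn beta n tips of length j into beta n
tips of length j + l, and iterating gives length e n p.  For the block estimate
the unused pairs must be spread evenly between vertex sets: the proportion of
unused pairs in a fixed set of pairs is a martingale, and Azuma's inequality beats
the union bound over all 4^n pairs of vertex sets. *)

Set Implicit Arguments.
Unset Strict Implicit.
Unset Printing Implicit Defensive.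

Import Order.TTheory GRing.Theory Num.Theory.
Import numFieldNormedType.Exports.

Local Open Scope ring_scope.

(** * Uniform drawing without replacement *)

Section Draws.
Context (R : realType) (T : finType) (U : {set T}).
Implicit Types (s : seq T) (phi psi : seq T -> R) (m : nat) (c : R).

Definition draw_seq s := uniq s && all (mem U) s.

(* Expectation of phi after one more uniform draw without replacement; it is 0 once
   U is exhausted, by division by zero. *)
Definition draw_step phi s : R :=
  (#|U :\: [set x in s]|%:R)^-1 * \sum_(e in U :\: [set x in s]) phi (rcons s e).

(** Conditional expectation of [phi] after m more draws, given the history [s]; no sample space is
    built. *)
Definition draws m phi : seq T -> R := iter m draw_step phi.

Lemma draw_seq_nil : draw_seq [::]. Proof. by []. Qed.

Lemma card_undrawn s : draw_seq s -> #|U :\: [set x in s]| = (#|U| - size s)%N.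
Proof.
case/andP=> us /allP sU.
have -> : size s = #|[set x in s]|.
  by rewrite -(card_uniqP us); apply: eq_card => x; rewrite inE.
by rewrite cardsDS //; apply/fintype.subsetP => x; rewrite inE => /sU.
Qed.

Lemma draw_seq_rcons s e :
  draw_seq s -> e \in U :\: [set x in s] -> draw_seq (rcons s e).
Proof.
case/andP=> us sU; rewrite !inE => /andP[es eU].
by rewrite /draw_seq rcons_uniq es us all_rcons sU /= eU.
Qed.

Lemma draw_seq_size s : draw_seq s -> (size s <= #|U|)%N.
Proof.
case/andP=> us /allP sU; rewrite -(card_uniqP us).
by apply/subset_leq_card/fintype.subsetP => x /sU.
Qed.

Lemma draw_step_le phi psi s : draw_seq s ->
    (forall e, e \in U :\: [set x in s] -> phi (rcons s e) <= psi (rcons s e)) ->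
  draw_step phi s <= draw_step psi s.
Proof.
move=> ds le; rewrite ler_wpM2l ?invr_ge0 ?ler0n //.
exact: ler_sum.
Qed.

Lemma draw_step_const c s : (0 < #|U :\: [set x in s]|)%N ->
  draw_step (fun=> c) s = c.
Proof.
move=> pos; rewrite /draw_step sumr_const -[c *+ _]mulr_natl mulKf //.
by rewrite pnatr_eq0 -lt0n.
Qed.

Lemma draw_step_const_le c s : 0 <= c -> draw_step (fun=> c) s <= c.
Proof.
move=> c0; have [pos|] := posnP #|U :\: [set x in s]|; last first.
  by move/draw_step_const => ->.
by rewrite /draw_step pos invr0 mul0r.
Qed.

Lemma draw_stepD phi psi s :
  draw_step (fun t => phi t + psi t) s = draw_step phi s + draw_step psi s.
Proof. by rewrite /draw_step big_split mulrDr. Qed.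

Lemma draw_stepZ c phi s : draw_step (fun t => c * phi t) s = c * draw_step phi s.
Proof. by rewrite /draw_step -mulr_sumr mulrCA. Qed.

Lemma draw_step_sum (I : Type) (r : seq I) (P : pred I) (F : I -> seq T -> R) s :
  draw_step (fun t => \sum_(i <- r | P i) F i t) s =
  \sum_(i <- r | P i) draw_step (F i) s.
Proof. by rewrite /draw_step exchange_big /= mulr_sumr. Qed.

Lemma drawsS m phi s : draws m.+1 phi s = draw_step (draws m phi) s.
Proof. by []. Qed.

Lemma drawsSr m phi s : draws m.+1 phi s = draws m (draw_step phi) s.
Proof. by rewrite /draws iterSr. Qed.

Lemma drawsD m1 m2 phi s : draws (m1 + m2) phi s = draws m1 (draws m2 phi) s.
Proof. by rewrite /draws iterD. Qed.

Lemma draws_le_in m phi psi s : draw_seq s ->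
    (forall t, draw_seq t -> size t = (size s + m)%N -> prefix s t -> phi t <= psi t) ->
  draws m phi s <= draws m psi s.
Proof.
elim: m s => [|m IH] s ds le.
  by apply: le; rewrite ?addn0 ?prefix_refl.
apply: draw_step_le => // e eU; apply: IH; first exact: draw_seq_rcons.
move=> t dt st pt; apply: le => //; first by rewrite st size_rcons addSnnS.
by apply: prefix_trans pt; exact: prefix_rcons.
Qed.

Lemma draws_le m phi psi s : draw_seq s -> (forall t, phi t <= psi t) ->
  draws m phi s <= draws m psi s.
Proof. by move=> ds le; apply: draws_le_in => // t _ _ _; exact: le. Qed.

Lemma draws_const_le m c s : 0 <= c -> draw_seq s -> draws m (fun=> c) s <= c.
Proof.
move=> c0; elim: m s => [//|m IH] s ds.
apply: (le_trans _ (draw_step_const_le s c0)).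
by apply: draw_step_le => // e eU; apply/IH/draw_seq_rcons.
Qed.

Lemma draws_ge0 m phi s : draw_seq s -> (forall t, 0 <= phi t) ->
  0 <= draws m phi s.
Proof.
move=> ds p0; elim: m s ds => [|m IH] s ds /=; first exact: p0.
rewrite mulr_ge0 ?invr_ge0 ?ler0n // sumr_ge0 // => e eU.
by apply/IH/draw_seq_rcons.
Qed.

Lemma draws_const m c s : draw_seq s -> (size s + m <= #|U|)%N ->
  draws m (fun=> c) s = c.
Proof.
elim: m s => [//|m IH] s ds le.
have pos : (0 < #|U :\: [set x in s]|)%N.
  by rewrite card_undrawn // subn_gt0; apply: leq_trans le; rewrite -addSnnS leq_addr.
rewrite drawsS -[RHS](draw_step_const c pos).
congr (_ * _); apply: eq_bigr => e eU.
by apply: IH; [exact: draw_seq_rcons | rewrite size_rcons addSnnS].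
Qed.

Lemma drawsDf m phi psi s :
  draws m (fun t => phi t + psi t) s = draws m phi s + draws m psi s.
Proof.
elim: m s => [//|m IH] s; rewrite !drawsS -draw_stepD.
by congr (draw_step _ _); apply: funext.
Qed.

Lemma drawsZ m c phi s : draws m (fun t => c * phi t) s = c * draws m phi s.
Proof.
elim: m s => [//|m IH] s; rewrite !drawsS -draw_stepZ.
by congr (draw_step _ _); apply: funext.
Qed.

Lemma draws_sum m (I : Type) (r : seq I) (P : pred I) (F : I -> seq T -> R) s :
  draws m (fun t => \sum_(i <- r | P i) F i t) s =
  \sum_(i <- r | P i) draws m (F i) s.
Proof.
elim: m s => [//|m IH] s; rewrite drawsS -draw_step_sum.
by congr (draw_step _ _); apply: funext.
Qed.

(** The supermartingale bound behind both exponential-moment estimates below: the last draw is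
    averaged first and costs a factor c. *)
Lemma draws_geometric m phi s c : 0 <= c -> draw_seq s ->
    (forall t, draw_seq t -> prefix s t -> (size t < size s + m)%N ->
      draw_step phi t <= c * phi t) ->
  draws m phi s <= c ^+ m * phi s.
Proof.
move=> c0; elim: m => [|m IH] ds le; first by rewrite mul1r.
rewrite drawsSr exprS -mulrA.
apply: (@le_trans _ _ (draws m (fun t => c * phi t) s)).
  apply: draws_le_in => // t dt st pt; apply: le => //.
  by rewrite st addnS ltnS.
rewrite drawsZ ler_wpM2l //; apply: IH => // t dt pt st; apply: le => //.
by rewrite addnS ltnS ltnW.
Qed.

Fixpoint draw_seqs m : seq (seq T) :=
  if m is m'.+1 then
    [seq rcons s e | s <- draw_seqs m', e <- enum (U :\: [set x in s])]
  else [:: [::]].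

Lemma mem_draw_seqs m s : (s \in draw_seqs m) = draw_seq s && (size s == m).
Proof.
elim: m s => [|m IH] s /=.
  by rewrite inE; case: s => //= x s; rewrite andbF.
apply/allpairsPdep/idP => [[t [e [+ + ->]]]|].
  rewrite IH mem_enum => /andP[dt /eqP <-] eU.
  by rewrite draw_seq_rcons // size_rcons eqxx.
case/andP; elim/last_ind: s => [//|s e _].
rewrite /draw_seq rcons_uniq all_rcons size_rcons eqSS.
move=> /andP[/andP[es us] /andP[eU sU]] /eqP sz.
exists s, e; rewrite IH mem_enum !inE /draw_seq us sU sz eqxx es.
by split.
Qed.

Lemma uniq_draw_seqs m : uniq (draw_seqs m).
Proof.
elim: m => [//|m IH] /=; apply: allpairs_uniq_dep => //.
  by move=> s _; exact: enum_uniq.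
by move=> [s e] [s' e'] _ _ /= /rcons_inj [<- <-].
Qed.

(** Links the operator to counting, so that drawn sequences can later be matched with edge
    orderings: all [#|U| ^_ m] sequences are equally likely. *)
Lemma draws_sum_seqs m phi : (m <= #|U|)%N ->
  (#|U| ^_ m)%:R * draws m phi [::] = \sum_(s <- draw_seqs m) phi s.
Proof.
elim: m phi => [|m IH] phi mU; first by rewrite big_seq1 mul1r.
rewrite drawsSr ffactnSr natrM mulrAC IH ?(ltnW mU) // mulr_suml.
rewrite [RHS](big_allpairs_dep (op := +%R)) /=.
rewrite big_seq_cond [RHS]big_seq_cond; apply: eq_bigr => s.
rewrite andbT mem_draw_seqs => /andP[ds /eqP sz].
rewrite /draw_step card_undrawn // sz mulrC mulVKf ?big_enum //.
by rewrite pnatr_eq0 -lt0n subn_gt0.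
Qed.

End Draws.

(** Take the inverse square of 1 - u/2 <= exp(-u/2); the product (1 + u + u^2)(1 - u/2)^2 exceeds 1
    by u^2/4 (1 - 3u + u^2), which is nonnegative for u <= 1/3. *)
Lemma expR_le_quadratic (R : realType) (u : R) : `|u| <= 3^-1 ->
  expR u <= 1 + u + u ^+ 2.
Proof.
rewrite ler_norml => /andP[lo hi].
have -> : expR u = ((expR (- (u / 2))) ^+ 2)^-1.
  by rewrite -expRM_natr -expRN; congr expR; field.
have h1 : 1 - u / 2 <= expR (- (u / 2)) by apply: expR_ge1Dx.
have h0 : 0 < 1 - u / 2 by lra.
have h2 : (1 - u / 2) ^+ 2 <= expR (- (u / 2)) ^+ 2.
  by rewrite ler_sqr ?nnegrE ?expR_ge0 // ltW.
have h3 : 0 < (1 - u / 2) ^+ 2 by rewrite exprn_gt0.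
apply: (@le_trans _ _ ((1 - u / 2) ^+ 2)^-1).
  by rewrite lef_pV2 ?posrE // (lt_le_trans h3).
rewrite -[X in X <= _]div1r ler_pdivrMr //.
have : 0 <= u ^+ 2 / 4 * (1 - 3 * u + u ^+ 2).
  by rewrite mulr_ge0 ?divr_ge0 ?sqr_ge0 //; nra.
by nra.
Qed.

Section Density.
Context (R : realType) (T : finType) (U : {set T}).
Implicit Types (s : seq T) (S : {set T}) (F : {set {set T}}) (d th : R).

(** For S inside [U], the chance that the next draw lands in S. *)
Definition density S s : R :=
  #|S :\: [set x in s]|%:R / #|U :\: [set x in s]|%:R.

Lemma setD_rcons (A : {set T}) s e :
  A :\: [set x in rcons s e] = (A :\: [set x in s]) :\ e.
Proof. by apply/setP => x; rewrite !inE mem_rcons inE negb_or; rewrite andbA. Qed.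

Lemma cardsD1R (A : {set T}) e :
  #|A :\ e|%:R = #|A|%:R - (e \in A)%:R :> R.
Proof. by rewrite [in RHS](cardsD1 e A) natrD addrAC subrr add0r. Qed.

Lemma density_rcons S s e : (1 < #|U :\: [set x in s]|)%N ->
    e \in U :\: [set x in s] ->
  density S (rcons s e) - density S s =
  (#|S :\: [set x in s]|%:R - #|U :\: [set x in s]|%:R * (e \in S :\: [set x in s])%:R)
    / (#|U :\: [set x in s]|%:R * (#|U :\: [set x in s]|%:R - 1)).
Proof.
move=> b1 eU; rewrite /density !setD_rcons !cardsD1R eU /=.
have b1' : 1 < #|U :\: [set x in s]|%:R :> R by rewrite ltr1n.
by field; rewrite !gt_eqF // ?subr_gt0 //; apply: lt_trans b1'.
Qed.

(** The martingale property: with a of the b undrawn elements in S, the increments are proportional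
    to a - b on S and to a off S, and a (a - b) + (b - a) a = 0. *)
Lemma sum_density_increment S s : S \subset U ->
    (1 < #|U :\: [set x in s]|)%N ->
  \sum_(e in U :\: [set x in s]) (density S (rcons s e) - density S s) = 0.
Proof.
move=> SU b1.
under eq_bigr => e eU do rewrite density_rcons //.
rewrite -mulr_suml sumrB sumr_const -mulr_sumr.
have -> : \sum_(e in U :\: [set x in s]) (e \in S :\: [set x in s])%:R
          = #|S :\: [set x in s]|%:R :> R.
  rewrite -natr_sum -sum1_card [in RHS]big_mkcond [in LHS]big_mkcond /=.
  congr (_%:R); apply: eq_bigr => e _; rewrite !inE.
  by case: (e \in s) => //=; case: ifP => // /negbT eU; case: ifP => // /(fintype.subsetP SU);
    rewrite (negbTE eU).
by rewrite -[X in X - _]mulr_natl subrr mul0r.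
Qed.

Lemma density_increment S s e : S \subset U ->
    (1 < #|U :\: [set x in s]|)%N -> e \in U :\: [set x in s] ->
  `|density S (rcons s e) - density S s| <= (#|U :\: [set x in s]|%:R - 1)^-1.
Proof.
move=> SU b1 eU; rewrite density_rcons //.
have b1' : 1 < #|U :\: [set x in s]|%:R :> R by rewrite ltr1n.
have ab : #|S :\: [set x in s]|%:R <= #|U :\: [set x in s]|%:R :> R.
  by rewrite ler_nat subset_leq_card // finset.setSD.
have a0 : 0 <= #|S :\: [set x in s]|%:R :> R by [].
set a := #|S :\: _|%:R in ab a0 *; set b := #|U :\: _|%:R in b1' ab *.
have bb : 0 < b * (b - 1) by nra.
rewrite normrM normfV (gtr0_norm bb) ler_pdivrMr //.
have -> : (b - 1)^-1 * (b * (b - 1)) = b by field; rewrite gt_eqF // subr_gt0.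
by rewrite ler_norml; case: (e \in _) => /=; apply/andP; split; nra.
Qed.

(** Increments are at most 1/D, so [th] times them is at most 1/3 and the exponential may be
    replaced by its quadratic bound; the linear term averages to 0. *)
Lemma density_exp_step S s th D : S \subset U -> 0 <= th -> 3 * th <= D ->
    0 < D -> D + 1 <= #|U :\: [set x in s]|%:R ->
  draw_step U (fun t => expR (- th * density S t)) s
    <= (1 + th ^+ 2 / D ^+ 2) * expR (- th * density S s).
Proof.
move=> SU th0 thD D0 Db.
have b1 : (1 < #|U :\: [set x in s]|)%N by rewrite -(ltr1n R); lra.
rewrite /draw_step ler_pdivrMl; last by rewrite ltr0n (ltnW b1).
set b := #|U :\: _|%:R in Db *.
have incr e : e \in U :\: [set x in s] ->
    expR (- th * density S (rcons s e)) <=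
    expR (- th * density S s) *
      ((1 + th ^+ 2 / D ^+ 2) - th * (density S (rcons s e) - density S s)).
  move=> eU; have := density_increment SU b1 eU.
  set X := density S s; set Y := density S _ => le.
  have -> : - th * Y = - th * X + - th * (Y - X) by ring.
  rewrite expRD ler_pM2l ?expR_gt0 //.
  have le' : `|Y - X| <= D^-1.
    by apply: le_trans le _; rewrite lef_pV2 ?posrE // -/b; lra.
  have tD : th * D^-1 <= 3^-1.
    by rewrite ler_pdivrMr //; lra.
  have nle : `|- th * (Y - X)| <= th / D.
    by rewrite normrM normrN (ger0_norm th0) ler_wpM2l.
  apply: le_trans (expR_le_quadratic (le_trans nle tD)) _.
  have : (- th * (Y - X)) ^+ 2 <= (th / D) ^+ 2.
    by rewrite -[X in X <= _]real_normK ?num_real // ler_sqr ?nnegrE // divr_ge0 // ltW.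
  by rewrite expr_div_n; lra.
apply: le_trans; first by apply: ler_sum; exact: incr.
rewrite -mulr_sumr sumrB -mulr_sumr sum_density_increment // mulr0 subr0.
rewrite sumr_const -[_ *+ #|_|]mulr_natl -/b le_eqVlt; apply/orP; left.
by apply/eqP; ring.
Qed.

(** Azuma's inequality for the lower tail: Markov's inequality applied to exp(- th density), with
    [th] left free until the end. *)
Lemma density_deviation S m d th D : S \subset U -> (m <= #|U|)%N ->
    0 <= th -> 3 * th <= D -> 0 < D -> D + m%:R <= #|U|%:R ->
  draws U m (fun t => (density S t < density S [::] - d)%R%:R) [::]
    <= expR (m%:R * (th ^+ 2 / D ^+ 2) - th * d).
Proof.
move=> SU mU th0 thD D0 Dm.
have geo : draws U m (fun t => expR (- th * density S t)) [::]
    <= (1 + th ^+ 2 / D ^+ 2) ^+ m * expR (- th * density S [::]).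
  apply: draws_geometric => //.
    by rewrite addr_ge0 // divr_ge0 ?sqr_ge0.
  (* Before each draw at most m - 1 elements are gone, so at least D + 1 remain. *)
  move=> t dt _ /= st; apply: density_exp_step => //.
  rewrite card_undrawn // natrB ?(draw_seq_size dt) //.
  have : (size t).+1%:R <= m%:R :> R by rewrite ler_nat.
  by rewrite -[in X in X -> _]natr1; lra.
apply: (@le_trans _ _ (draws U m (fun t => expR (th * (density S [::] - d)) *
                          expR (- th * density S t)) [::])).
  apply: draws_le => // t; rewrite -expRD.
  have [lt|_] := ltP; last exact: expR_ge0.
  rewrite /= -expR0 ler_expR; nra.
rewrite drawsZ; apply: le_trans (ler_wpM2l (expR_ge0 _) geo) _.
rewrite mulrCA -expRD.
have -> : th * (density S [::] - d) + - th * density S [::] = - (th * d) by ring.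
rewrite expRD ler_pM2r ?expR_gt0 // expRM_natl.
by rewrite lerXn2r ?nnegrE ?expR_ge0 ?expR_ge1Dx // addr_ge0 // divr_ge0 ?sqr_ge0.
Qed.

Definition dense F d s :=
  [forall S in F, density S [::] - d <= density S s].

(** All [(size s).+1] prefixes are tested, the empty one and [s] included, so the event passes to
    prefixes. *)
Definition always_dense F d s :=
  all (fun t => dense F d (take t s)) (iota 0 (size s).+1).

Lemma always_dense_rcons F d s e :
  always_dense F d (rcons s e) = always_dense F d s && dense F d (rcons s e).
Proof.
rewrite /always_dense size_rcons -[X in iota 0 X]addn1 iotaD all_cat /= !take0.
rewrite -[in take (size s).+1 _](size_rcons s e) take_size andbT -!andbA.
congr (_ && (_ && _)); apply: eq_in_all => t; rewrite mem_iota => /andP[_ ts].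
by rewrite -cats1 takel_cat // -ltnS.
Qed.

Lemma always_denseW F d s : always_dense F d s -> dense F d s.
Proof.
move/allP => /(_ (size s)); rewrite take_size; apply.
by rewrite mem_iota leq0n ltnSn.
Qed.

(** Union bound over the sets in F and over the draw after which density fails; it cannot fail
    before any draw, because d >= 0. *)
Lemma always_dense_fail F m d th D : (forall S, S \in F -> S \subset U) ->
    (m <= #|U|)%N -> 0 <= d -> 0 <= th -> 3 * th <= D -> 0 < D ->
    D + m%:R <= #|U|%:R ->
  draws U m (fun t => (~~ always_dense F d t)%:R) [::]
    <= m%:R * #|F|%:R * expR (m%:R * (th ^+ 2 / D ^+ 2) - th * d).
Proof.
move=> FU mU d0 th0 thD D0 Dm.
set B := expR _.
suff main k : (k <= m)%N ->
    draws U k (fun t => (~~ always_dense F d t)%:R) [::] <= k%:R * #|F|%:R * B.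
  exact: main.
have B0 : 0 <= B by exact: expR_ge0.
elim: k => [|k IH] km; first rewrite !mul0r /= /always_dense /= andbT.
  rewrite (_ : dense _ _ _) //; apply/forall_inP => S _.
  by rewrite gerBl.
rewrite -natr1 !mulrDl mul1r drawsSr.
have split1 t e : ((~~ always_dense F d (rcons t e))%:R : R) <=
    (~~ always_dense F d t)%:R + (~~ dense F d (rcons t e))%:R.
  by rewrite always_dense_rcons negb_and; do 2 case: (~~ _);
    rewrite ?addr0 ?add0r // lerDl.
apply: (@le_trans _ _ (draws U k (fun t => (~~ always_dense F d t)%:R +
          draw_step U (fun u => (~~ dense F d u)%:R) t) [::])).
  apply: draws_le_in => // t dt _ _.
  apply: le_trans (_ : draw_step U (fun u => (~~ always_dense F d t)%:R +
     (~~ dense F d u)%:R) t <= _).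
    by apply: draw_step_le.
  by rewrite draw_stepD lerD2r; apply: draw_step_const_le.
rewrite drawsDf lerD ?(IH (ltnW km)) // -drawsSr.
apply: (@le_trans _ _ (draws U k.+1 (fun t => \sum_(S in F)
    (density S t < density S [::] - d)%R%:R) [::])).
  apply: draws_le => // t.
  have [_|] := boolP (dense F d t); first by rewrite sumr_ge0.
  rewrite /dense negb_forall => /existsP[S]; rewrite negb_imply -ltNge => /andP[SF lt].
  by rewrite (bigD1 S) //= lt lerDl sumr_ge0.
rewrite draws_sum mulr_natl -sumr_const ler_sum // => S SF.
apply: le_trans (density_deviation (th := th) (D := D) _ _ _ _ _ _ _) _ => //.
- exact: FU.
- exact: leq_trans mU.
- apply: le_trans Dm; rewrite lerD2l ler_nat //.
rewrite ler_expR lerD2r ler_wpM2r ?ler_nat // divr_ge0 ?sqr_ge0 //.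
Qed.

End Density.

(** * Ends of increasing trails *)

Section Tips.
Context (n : nat).
Implicit Types (s : seq {set 'I_n}) (A B : {set 'I_n}) (k : nat).

(* When s enumerates the edges of a graph in increasing order, these are the end
   vertices of its increasing trails of length k: s being duplicate-free, so is any
   subsequence. *)
Definition tips k s : {set 'I_n} :=
  [set w | [exists x, [exists v : k.-tuple 'I_n,
     (last x v == w) && subseq (walk_edges (x :: v)) s]]].

Lemma tipsP k s w : reflect (exists x v, [/\ size v = k, last x v = w &
  subseq (walk_edges (x :: v)) s]) (w \in tips k s).
Proof.
rewrite inE; apply: (iffP existsP) => [[x /existsP[v /andP[/eqP lw sub]]]|].
  by exists x, v; rewrite size_tuple.
move=> [x [v [/eqP sz lw sub]]]; exists x; apply/existsP; exists (Tuple sz).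
by rewrite /= lw eqxx.
Qed.

Lemma tips0 s : tips 0 s = [set: 'I_n].
Proof.
apply/setP => w; rewrite finset.in_setT; apply/tipsP.
by exists w, [::]; split=> //; exact: sub0seq.
Qed.

Lemma tips_subseq k s s' : subseq s s' -> tips k s \subset tips k s'.
Proof.
move=> ss; apply/fintype.subsetP => w /tipsP[x [v [sz lw sub]]].
by apply/tipsP; exists x, v; split=> //; apply: subseq_trans ss.
Qed.

Lemma tips_prefix k s s' : prefix s s' -> tips k s \subset tips k s'.
Proof. by case/prefixP => t ->; apply/tips_subseq/prefix_subseq. Qed.

(** The newest pair comes last in the order, so it extends every increasing trail that ends at
    [w]. *)
Lemma tips_rcons k s w u :
  w \in tips k s -> u \in tips k.+1 (rcons s [set w; u]).
Proof.
move=> /tipsP[x [v [sz lw sub]]]; apply/tipsP; exists x, (rcons v u).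
rewrite size_rcons sz last_rcons; split=> //=.
by rewrite -!cats1 pairmap_cat /= lw cat_subseq.
Qed.

(** When A consists of tips one level below, drawing such a pair makes a vertex outside B a tip.
    Keeping the second end out of A lets the pair determine both ends, so the cardinal is a
    product. *)
Definition cross A B : {set {set 'I_n}} :=
  [set [set w; u] | w in A, u in ~: (A :|: B)].

Definition crosses : {set {set {set 'I_n}}} :=
  [set cross A B | A in [set: {set 'I_n}], B in [set: {set 'I_n}]].

Lemma cross_in A B : cross A B \in crosses.
Proof. by apply/imset2P; exists A B; rewrite ?inE. Qed.

Lemma cross_sub_pairs A B : cross A B \subset pairs n.
Proof.
apply/fintype.subsetP => _ /imset2P[w u wA + ->]; rewrite !inE negb_or => /andP[uA _].
by rewrite cards2; have [wu|//] := eqVneq w u; move: uA; rewrite -wu wA.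
Qed.

Lemma crosses_sub_pairs S : S \in crosses -> S \subset pairs n.
Proof. by case/imset2P => A B _ _ ->; exact: cross_sub_pairs. Qed.

Lemma card_crosses : (#|crosses| <= 4 ^ n)%N.
Proof.
rewrite /crosses curry_imset2X; apply: leq_trans (leq_imset_card _ _) _.
have -> : (4 ^ n = 2 ^ n * 2 ^ n)%N by rewrite -expnMn.
rewrite cardsX (_ : [set: {set 'I_n}] = powerset [set: 'I_n]); last first.
  by apply/setP => A; rewrite !inE finset.subsetT.
by rewrite card_powerset cardsT card_ord.
Qed.

Lemma card_cross A B : #|cross A B| = (#|A| * #|~: (A :|: B)|)%N.
Proof.
rewrite /cross curry_imset2X card_in_imset ?cardsX //.
move=> [w u] [w' u'] /=; rewrite !inE /= !negb_or.
move=> /andP[wA /andP[uA _]] /andP[wA' /andP[uA' _]] /setP eq.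
have := eq w; rewrite !inE eqxx /= => /esym/orP[/eqP ww|/eqP wu]; last first.
  by move: uA'; rewrite -wu wA.
have := eq u; rewrite !inE eqxx orbT => /esym/orP[/eqP uw|/eqP uu].
  by move: uA; rewrite uw wA'.
by rewrite ww uu.
Qed.

Lemma card_cross_ge (R : realType) A B :
  #|A|%:R * (n%:R - #|A|%:R - #|B|%:R) <= #|cross A B|%:R :> R.
Proof.
rewrite card_cross natrM ler_wpM2l // -addrA -opprD lerBlDr -!natrD ler_nat.
rewrite -[X in (X <= _)%N](card_ord n) -(cardsC (A :|: B)) addnC leq_add2l.
by rewrite cardsU leq_subr.
Qed.

Lemma card_pairs : #|pairs n| = 'C(n, 2).
Proof. by rewrite -[n in RHS]card_ord -card_draws; apply: eq_card => e; rewrite !inE. Qed.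

(** * Growth of the set of tips during one block *)

Section Growth.
Context (R : realType).
Implicit Types (b q z d : R).

Local Notation G := (always_dense (pairs n) crosses).

(** Failure event of a block: the pairs were evenly spread all along, yet the goal b is missed. It
    passes to prefixes, since tips are never lost. *)
Definition slow d b k s : bool := G d s && (#|tips k s|%:R < b)%R.

Lemma slow_rcons d b k s e : slow d b k (rcons s e) -> slow d b k s.
Proof.
rewrite /slow always_dense_rcons => /andP[/andP[-> _]] /=; apply: le_lt_trans.
by rewrite ler_nat subset_leq_card // tips_prefix // prefix_rcons.
Qed.

Lemma card_tips_rcons k s A e : A \subset tips k s ->
  (#|tips k.+1 s| + (e \in cross A (tips k.+1 s)) <= #|tips k.+1 (rcons s e)|)%N.
Proof.
move=> /fintype.subsetP As.
have sub : tips k.+1 s \subset tips k.+1 (rcons s e) by rewrite tips_prefix ?prefix_rcons.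
have [/imset2P[w u wA + def_e]|_] := boolP (e \in _); last first.
  by rewrite addn0 subset_leq_card.
rewrite !inE negb_or => /andP[_ uB].
rewrite addn1; apply/proper_card/properP; split=> //.
exists u; last by rewrite inE.
by rewrite def_e tips_rcons ?As.
Qed.

(* The new tips dominate a binomial count, so [expR (- z * #|tips k.+1 t|)], killed
   once the target b is reached, decays geometrically. *)
Lemma slow_step k s A d b q z : draw_seq (pairs n) s ->
    A \subset tips k s -> 0 <= z <= 3^-1 ->
    (forall B, #|B|%:R < b -> q <= density R (pairs n) (cross A B) [::] - d) ->
  draw_step (pairs n) (fun t => (slow d b k.+1 t)%:R * expR (- z * #|tips k.+1 t|%:R)) s
  <= expR (- q * (z - z ^+ 2)) *
     ((slow d b k.+1 s)%:R * expR (- z * #|tips k.+1 s|%:R)).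
Proof.
move=> ds As /andP[z0 z1] dens.
have [|slw] := boolP (slow d b k.+1 s); last first.
  rewrite mul0r mulr0 /draw_step big1 ?mulr0 // => e _.
  by rewrite (contraNF (@slow_rcons _ _ _ _ _) slw) mul0r.
move=> /andP[Gs lt]; rewrite mul1r.
set B := tips k.+1 s in lt *.
(* With all pairs drawn, [draw_step] is 0 and the bound is trivial. *)
have [U0|Upos] := posnP #|pairs n :\: [set x in s]|.
  by rewrite /draw_step U0 invr0 mul0r mulr_ge0 ?expR_ge0.
set y := expR (- z).
have y1 : y <= 1 - (z - z ^+ 2).
  have := @expR_le_quadratic R (- z); rewrite normrN ger0_norm // sqrrN.
  by move=> /(_ z1); rewrite -/y; lra.
have qD : q <= density R (pairs n) (cross A B) s.
  apply: le_trans (dens B lt) _.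
  by move/always_denseW: Gs => /forall_inP/(_ _ (cross_in A B)).
(* Here [last] reads off the pair just drawn; if it lies in [cross A B], a tip is gained and the
   weight falls at least by the factor [y]. *)
apply: (@le_trans _ _ (draw_step (pairs n) (fun t =>
   expR (- z * #|B|%:R) * (1 - (1 - y) * (last finset.set0 t \in cross A B)%:R)) s)).
  apply: draw_step_le => // e eU; rewrite last_rcons.
  have := card_tips_rcons e As; rewrite -/B => le.
  apply: (@le_trans _ _ (expR (- z * (#|B| + (e \in cross A B))%:R))).
    rewrite -[X in _ <= X]mul1r ler_pM ?expR_ge0 //; first by case: (slow _ _ _ _).
    by rewrite ler_expR !mulNr lerN2 ler_wpM2l // ler_nat.
  rewrite natrD mulrDr expRD ler_pM2l ?expR_gt0 //.
  by case: (e \in _); rewrite ?mulr1 ?mulr0 ?expR0 -/y; lra.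
rewrite draw_stepZ mulrC ler_pM2r ?expR_gt0 //.
have -> : draw_step (pairs n) (fun t => 1 - (1 - y) * (last finset.set0 t \in cross A B)%:R) s
    = 1 - (1 - y) * density R (pairs n) (cross A B) s.
  rewrite /draw_step /density sumrB sumr_const -mulr_sumr mulrBr.
  rewrite mulVf ?pnatr_eq0 -?lt0n //; congr (_ - _).
  rewrite mulrCA; congr (_ * _); rewrite mulrC; congr (_ / _).
  under eq_bigr do rewrite last_rcons.
  rewrite -natr_sum -sum1_card [in RHS]big_mkcond [in LHS]big_mkcond /=.
  congr (_%:R); apply: eq_bigr => e _; rewrite !inE.
  case: (e \in s) => //=.
  have [/(fintype.subsetP (cross_sub_pairs A B))|_] := boolP (e \in cross A B); last by case: ifP.
  by rewrite inE => ->.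
apply: le_trans (expR_ge1Dx _).
have y1' : 0 <= z - z ^+ 2 by nra.
have D0 : 0 <= density R (pairs n) (cross A B) s by rewrite divr_ge0.
set D := density _ _ _ _ in qD D0 *.
have : (z - z ^+ 2) * q <= (z - z ^+ 2) * D by rewrite ler_wpM2l.
have : (z - z ^+ 2) * D <= (1 - y) * D by rewrite ler_wpM2r //; lra.
by lra.
Qed.

(** Markov's inequality: on the slow event exp(z (b - number of tips)) is at least 1. A is fixed at
    the start of the block and remains a set of tips. *)
Lemma slow_draws m k s A d b b0 q z : draw_seq (pairs n) s ->
    A \subset tips k s -> 0 <= z <= 3^-1 -> b0 <= #|tips k.+1 s|%:R ->
    (forall B, #|B|%:R < b -> q <= density R (pairs n) (cross A B) [::] - d) ->
  draws (pairs n) m (fun t => (slow d b k.+1 t)%:R) s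
  <= expR (z * (b - b0) - m%:R * (q * (z - z ^+ 2))).
Proof.
move=> ds As zb le_b0 dens; have /andP[z0 _] := zb.
apply: (@le_trans _ _ (draws (pairs n) m (fun t => expR (z * b) *
   ((slow d b k.+1 t)%:R * expR (- z * #|tips k.+1 t|%:R))) s)).
  apply: draws_le => // t; case: (boolP (slow _ _ _ _)) => [/andP[_ lt]|_].
    rewrite !mul1r -expRD -[X in X <= _]expR0 ler_expR.
    have : 0 <= z * (b - #|tips k.+1 t|%:R) by rewrite mulr_ge0 // subr_ge0 ltW.
    by lra.
  by rewrite mul0r mulr0.
rewrite drawsZ mulrBr -addrA expRD ler_pM2l ?expR_gt0 //.
apply: (@le_trans _ _ (expR (- q * (z - z ^+ 2)) ^+ m *
   ((slow d b k.+1 s)%:R * expR (- z * #|tips k.+1 s|%:R)))).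
  apply: draws_geometric => // t dt pt _.
  apply: (slow_step (A := A)) => //.
  by apply: (fintype.subset_trans As); exact: tips_prefix.
rewrite -expRM_natl addrC expRD ler_pM ?expR_ge0 ?mulr_ge0 ?expR_ge0 //.
  by rewrite mulNr mulrN.
apply: (@le_trans _ _ (expR (- z * #|tips k.+1 s|%:R))).
  by rewrite ler_piMl ?expR_ge0 //; case: (slow _ _ _ _).
by rewrite ler_expR mulNr lerN2 ler_wpM2l.
Qed.

End Growth.
End Tips.

(** * Chaining blocks into long trails *)

(** Used to trim a set of tips to about its target size, so that few vertices are excluded as second
    ends. *)
Lemma subset_card_approx (R : realType) (T : finType) (B : {set T}) (c : R) :
    0 <= c -> c <= #|B|%:R ->
  exists A : {set T}, [/\ A \subset B, c <= #|A|%:R & #|A|%:R <= c + 1].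
Proof.
move=> c0 cB; have [aB|Ba] := leqP (Num.trunc c).+1 #|B|; last first.
  exists B; split=> //; apply: (@le_trans _ _ (Num.trunc c)%:R).
    by rewrite ler_nat -ltnS.
  by rewrite ler_wpDr // truncn_le.
have [s [us sz sB]] := card_geqP aB.
exists [set y in s]; have -> : #|[set y in s]| = (Num.trunc c).+1.
  by rewrite -sz -(card_uniqP us); apply: eq_card => y; rewrite inE.
split; first by apply/fintype.subsetP => y; rewrite inE => /sB.
  by rewrite ltW // truncnS_gt.
by rewrite -natr1 lerD2r truncn_le.
Qed.

Section Chain.
Context (R : realType) (T : finType) (U : {set T}).
Implicit Types (s t : seq T) (G : pred (seq T)).

Lemma draws_pred_closed_le0 G (P : pred (seq T)) m s :
    (forall t e, G (rcons t e) -> G t) -> draw_seq U s -> ~~ G s ->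
  draws U m (fun t => (G t && P t)%:R) s <= 0 :> R.
Proof.
move=> Gcl ds Gs; apply: le_trans (draws_const_le m (lexx 0) ds).
apply: draws_le_in => // t _ _ /prefixP[u ->].
suff -> : G (s ++ u) = false by [].
apply: contraNF Gs; elim/last_ind: u => [|u e IH]; first by rewrite cats0.
by rewrite -rcons_cat => /Gcl.
Qed.

(** Union bound over stages of m draws each. [G] is kept in the event so that histories violating it
    need no control: once it fails, it fails for every extension. *)
Lemma draws_chain G (P : nat -> pred (seq T)) m (err : R) i s :
    (forall t e, G (rcons t e) -> G t) -> 0 <= err ->
    (forall j t, draw_seq U t -> P j t ->
      draws U m (fun u => (G u && ~~ P j.+1 u)%:R) t <= err) ->
    draw_seq U s -> P 0%N s ->
  draws U (i * m) (fun t => (G t && ~~ P i t)%:R) s <= i%:R * err.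
Proof.
move=> Gcl err0 step ds P0; elim: i => [|i IH]; first by rewrite mul0n /= P0 andbF mul0r.
rewrite mulSnr drawsD -natr1 mulrDl mul1r.
apply: (@le_trans _ _ (draws U (i * m) (fun t => (G t && ~~ P i t)%:R + err) s)).
  apply: draws_le_in => // t dt _ _.
  have [Gt|nGt] := boolP (G t); last first.
    by apply: le_trans (draws_pred_closed_le0 _ _ Gcl dt nGt) _; rewrite add0r.
  have [Pt|nPt] := boolP (P i t); first by rewrite add0r; exact: step.
  apply: (@le_trans _ _ 1); last by rewrite lerDl.
  apply: le_trans (draws_const_le m ler01 dt).
  by apply: draws_le => // u; case: (_ && _).
by rewrite drawsDf lerD // draws_const_le.
Qed.

End Chain.

Section Iteration.
Context (R : realType) (n l L : nat) (a0 x d z M lam : R).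
Context (a0_ge0 : 0 <= a0) (x0 : 0 <= x) (x1 : x <= 1) (zb : 0 <= z <= 3^-1).
Context (nM : 2 * M + 1 <= n%:R).
(** [gain_ok] bounds the exponent of [slow_draws] for a block of L draws that must add [x * T] tips
    to a level when the level below has T. No positive target lies below [a0 * x ^+ l]. *)
Context (gain_ok : forall T : R, a0 * x ^+ l <= T ->
  z * (x * T) - L%:R * ((T * (n%:R - 2 * M - 1) / 'C(n, 2)%:R - d) * (z - z ^+ 2))
    <= - lam).

Local Notation G := (always_dense (pairs n) (crosses n) d).

(* Number of tips of trails of length j + k demanded r blocks after there were a0
   tips of length j; each block multiplies by x and raises k by one, whence the
   binomial coefficient. *)
Definition target r k : R := a0 * 'C(r, k)%:R * x ^+ k.

Definition reached j r (s : seq {set 'I_n}) : bool :=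
  [forall k : 'I_l.+1, target r k <= #|tips (j + k) s|%:R].

Lemma target_ge0 r k : 0 <= target r k.
Proof. by rewrite !mulr_ge0 ?exprn_ge0. Qed.

(** Pascal's rule: one block keeps the target of level k + 1 and adds x times that of level k. *)
Lemma targetSS r k : target r.+1 k.+1 = target r k.+1 + x * target r k.
Proof. by rewrite /target binS natrD exprS; ring. Qed.

Lemma target_le K r k : (r <= K)%N -> a0 * (2 ^ K)%:R <= M -> target r k <= M.
Proof.
move=> rK; apply: le_trans; rewrite /target -[X in _ <= X]mulr1.
rewrite ler_pM ?mulr_ge0 ?exprn_ge0 ?exprn_ile1 //.
rewrite ler_wpM2l // ler_nat; apply: leq_trans (leq_pexp2l (ltn0Sn 1) rK).
have [rk|kr] := ltnP r k; first by rewrite bin_small.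
(* C(r, k) is one term of the expansion of (1 + 1)^r. *)
rewrite (Pascal 1 1) (bigD1 (Ordinal (kr : (k < r.+1)%N))) //=.
by rewrite !exp1n !muln1 leq_addr.
Qed.

Lemma reached_tips j r s k : reached j r s -> (k <= l)%N ->
  target r k <= #|tips (j + k) s|%:R.
Proof. by move=> /forallP rs kl; exact: (rs (Ordinal (kl : (k < l.+1)%N))). Qed.

Lemma block_slow K j r s k : (r.+1 <= K)%N -> a0 * (2 ^ K)%:R <= M ->
    draw_seq (pairs n) s -> reached j r s -> (k < l)%N ->
  draws (pairs n) L (fun t => (slow d (target r.+1 k.+1) (j + k).+1 t)%:R) s
    <= expR (- lam).
Proof.
move=> rK KM ds rs kl.
(* For k > r the target is 0 and cannot be missed. *)
have [rk|kr] := ltnP r k.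
  apply: le_trans (expR_ge0 _); apply: le_trans (draws_const_le L (lexx 0) ds).
  apply: draws_le => // t; rewrite /slow /target bin_small //.
  by rewrite mulr0 mul0r ltNge ler0n andbF.
set T := target r k.
have T0 : 0 <= T by exact: target_ge0.
have TA : T <= #|tips (j + k) s|%:R by apply: reached_tips (ltnW kl).
have TM : T <= M by apply: target_le KM; exact: ltnW.
have amin : a0 * x ^+ l <= T.
  rewrite /T /target -mulrA ler_wpM2l //.
  apply: (@le_trans _ _ (x ^+ k)).
    by rewrite ler_wiXn2l // ltnW.
  by rewrite ler_peMl ?exprn_ge0 // ler1n bin_gt0.
(* The trimmed A has at most T + 1 <= M + 1 elements and B at most M, whence n - 2 M - 1 in the
   density bound. *)
have [A [As TA' AT]] := subset_card_approx T0 TA.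
apply: le_trans (slow_draws (A := A) (b0 := target r k.+1) (z := z)
  (q := T * (n%:R - 2 * M - 1) / 'C(n, 2)%:R - d) _ ds As zb _ _) _.
- by rewrite -addnS; apply: reached_tips.
- move=> B BM; rewrite lerB // /density.
  have set_nil : [set y in [::]] = finset.set0 :> {set {set 'I_n}}.
    by apply/setP => y; rewrite !inE.
  rewrite set_nil !finset.setD0 card_pairs ler_wpM2r ?invr_ge0 //.
  apply: le_trans (card_cross_ge R A B).
  have : #|B|%:R <= M by rewrite ltW // (lt_le_trans BM) // (target_le _ rK KM).
  move=> BM1; rewrite ler_pM //; first by rewrite -addrA -opprD subr_ge0.
  rewrite -[leLHS]addrA -[leRHS]addrA -!opprD lerD2l lerN2.
  apply: le_trans (lerD AT BM1) _.
  by rewrite mulr_natl mulr2n addrAC !lerD2r.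
rewrite ler_expR; apply: le_trans (gain_ok amin).
by rewrite targetSS [target r k.+1 + _]addrC addrK.
Qed.

Lemma block_reached K j r s : (r.+1 <= K)%N -> a0 * (2 ^ K)%:R <= M ->
    draw_seq (pairs n) s -> reached j r s ->
  draws (pairs n) L (fun t => (G t && ~~ reached j r.+1 t)%:R) s
    <= l%:R * expR (- lam).
Proof.
move=> rK KM ds rs.
apply: (@le_trans _ _ (draws (pairs n) L (fun t =>
    \sum_(k < l) (slow d (target r.+1 k.+1) (j + k).+1 t)%:R) s)).
  apply: draws_le_in => // t _ _ pt.
  have [/andP[Gt]|_] := boolP (_ && _); last by rewrite sumr_ge0.
  rewrite negb_forall => /existsP[[k kl]]; rewrite -ltNge /=.
  (* Level 0 keeps the target [a0] after every block and loses no tips; a miss at level k + 1 is a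
     slow event. *)
  case: k kl => [|k] kl lt.
    move: lt; rewrite ltNge => /negP[]; apply: le_trans (_ : target r 0 <= _).
      by rewrite /target !bin0.
    apply: le_trans (reached_tips rs (leq0n l)) _.
    by rewrite ler_nat subset_leq_card // tips_prefix.
  rewrite (bigD1 (Ordinal (kl : (k < l)%N))) //= /slow Gt -addnS lt.
  by rewrite lerDl sumr_ge0.
rewrite draws_sum [X in _ <= X]mulr_natl -[l in X in _ <= X]card_ord -sumr_const.
by apply: ler_sum => k _; apply: block_slow rK KM ds rs (ltn_ord k).
Qed.

(** K blocks raise the level by l at no cost in tips, since the final target a0 C(K, l) x^l is at
    least a0. With r = 0 only the lowest level is constrained, C(0, k) being 0 for k > 0. *)
Lemma chunk_reached K j s : a0 * (2 ^ K)%:R <= M ->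
    1 <= 'C(K, l)%:R * x ^+ l -> draw_seq (pairs n) s -> reached j 0 s ->
  draws (pairs n) (K * L) (fun t => (G t && ~~ reached (j + l) 0 t)%:R) s
    <= K%:R * (l%:R * expR (- lam)).
Proof.
move=> KM Kl ds r0.
(* [draws_chain] asks for every stage, but a block is controlled only for r < K; the guard makes
   later stages vacuous. *)
apply: (@le_trans _ _ (draws (pairs n) (K * L)
    (fun t => (G t && ~~ ((K <= K)%N ==> reached j K t))%:R) s)).
  apply: draws_le => // t; rewrite leqnn ler_nat.
  have [//|nr] := boolP (reached (j + l) 0 t); first by rewrite andbF.
  rewrite andbT; case: (G t) => //=.
  rewrite lt0b; apply: contra nr => rK; apply/forallP => -[[|k] kl] /=.
    rewrite /target bin0 expr0 !mulr1 addn0.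
    apply: le_trans (reached_tips rK (leqnn l)).
    by rewrite /target -mulrA ler_peMr.
  by rewrite /target bin_small // mulr0 mul0r.
apply: (draws_chain (P := fun r t => (r <= K)%N ==> reached j r t)
  (err := l%:R * expR (- lam))) => //.
  by move=> t e; rewrite always_dense_rcons => /andP[].
move=> r t dt rt; have [rK|Kr] := ltnP r K; last first.
  apply: le_trans (_ : 0 <= _); last by rewrite mulr_ge0 ?expR_ge0.
  apply: le_trans (draws_const_le L (lexx 0) dt).
  by apply: draws_le => // u; rewrite andbF.
move: rt; rewrite (ltnW rK) /= => rt.
by apply: block_reached rK KM dt rt.
Qed.

Lemma chunks_reached K c : a0 * (2 ^ K)%:R <= M -> a0 <= n%:R ->
    1 <= 'C(K, l)%:R * x ^+ l ->
  draws (pairs n) (c * (K * L)) (fun t => (G t && ~~ reached (c * l) 0 t)%:R) [::]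
    <= c%:R * (K%:R * (l%:R * expR (- lam))).
Proof.
move=> KM an Kl.
apply: (draws_chain (P := fun c t => reached (c * l) 0 t)
  (err := K%:R * (l%:R * expR (- lam)))) => //.
- by move=> t e; rewrite always_dense_rcons => /andP[].
- by move=> j t dt rt; rewrite mulSnr; exact: chunk_reached.
(* At the start every vertex is a tip of length 0, and a0 <= n. *)
apply/forallP => -[[|k] kl] /=; rewrite /target.
  by rewrite bin0 expr0 !mulr1 mul0n addn0 tips0 cardsT card_ord.
by rewrite bin_small // mulr0 mul0r.
Qed.

(** Either a trail of length c l exists, or a chunk failed although density held, or density failed;
    the two error terms bound the last two cases. *)
Lemma tips_whp K c m th D : 0 < a0 -> a0 * (2 ^ K)%:R <= M -> a0 <= n%:R ->
    1 <= 'C(K, l)%:R * x ^+ l -> 0 <= d -> 0 <= th -> 3 * th <= D -> 0 < D ->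
    D + m%:R <= 'C(n, 2)%:R -> (c * (K * L) <= m)%N ->
  1 - (c%:R * (K%:R * (l%:R * expR (- lam)))
       + m%:R * (4 ^ n)%:R * expR (m%:R * (th ^+ 2 / D ^+ 2) - th * d))
    <= draws (pairs n) m (fun t => (tips (c * l) t != finset.set0)%:R) [::].
Proof.
move=> a0_gt0 KM an Kl d0 th0 thD D0 Dm cm.
have mN : (m <= #|pairs n|)%N.
  by rewrite card_pairs -(ler_nat R); apply: le_trans Dm; rewrite lerDr ltW.
have m0 : (size (@nil {set 'I_n}) + m <= #|pairs n|)%N by rewrite add0n.
rewrite lerBlDr -[leLHS](draws_const 1 (draw_seq_nil (pairs n)) m0).
apply: (@le_trans _ _ (draws (pairs n) m (fun t =>
  (tips (c * l) t != finset.set0)%:R + ((G t && (tips (c * l) t == finset.set0))%:R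
     + (~~ G t)%:R)) [::])).
  apply: draws_le => // t; rewrite -!natrD ler1n.
  by case: (G t); case: (_ == _).
rewrite drawsDf lerD2l drawsDf lerD //; last first.
  apply: le_trans (always_dense_fail (th := th) (D := D) _ _ _ _ _ _ _) _ => //.
  - exact: crosses_sub_pairs.
  - by rewrite card_pairs.
  by rewrite ler_wpM2r ?expR_ge0 // ler_wpM2l // ler_nat card_crosses.
apply: (le_trans _ (chunks_reached c KM an Kl)).
(* Draws after the last full chunk do no harm: density and absence of tips both pass to prefixes. *)
rewrite -(subnKC cm) drawsD; apply: draws_le_in => // t dt _ _.
apply: (@le_trans _ _ (draws (pairs n) (m - c * (K * L))
   (fun=> (G t && ~~ reached (c * l) 0 t)%:R) t)); last exact: draws_const_le.
apply: draws_le_in => // u _ _ /prefixP[v ->].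
have [/andP[Gu /eqP t0]|_] := boolP (G _ && _); last exact: ler0n.
have -> : G t.
  elim/last_ind: v Gu {t0} => [|v e IH]; first by rewrite cats0.
  by rewrite -rcons_cat always_dense_rcons => /andP[/IH].
suff -> : ~~ reached (c * l) 0 t by [].
apply/negP => rt; have := reached_tips rt (leq0n l).
have /eqP : tips (c * l) t == finset.set0.
  by rewrite -finset.subset0 -t0 tips_prefix // prefix_prefix.
by rewrite addn0 => ->; rewrite cards0 /target bin0 expr0 !mulr1 leNgt a0_gt0.
Qed.

End Iteration.

(** * Edge orderings as drawn sequences *)

Section Orderings.
Context (n : nat) (E : {set {set 'I_n}}).
Implicit Types (s : seq {set 'I_n}).

(** The order in which [s] lists the edges. The default of [insubd] is never reached when [s]
    enumerates E. *)
Definition rank_in s : {ffun edge E -> 'I_#|E|} :=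
  [ffun e => insubd (enum_rank_in (valP e) (val e)) (index (val e) s)].

Lemma size_enumeration s : uniq s -> [set x in s] = E -> size s = #|E|.
Proof.
by move=> us <-; rewrite -(card_uniqP us); apply: eq_card => x; rewrite inE.
Qed.

Lemma mem_enumeration s x : [set x in s] = E -> (x \in E) = (x \in s).
Proof. by move=> <-; rewrite inE. Qed.

Lemma rank_inE s (e : edge E) : uniq s -> [set x in s] = E ->
  val (rank_in s e) = index (val e) s.
Proof.
move=> us sE; have lt : (index (val e) s < #|E|)%N.
  by rewrite -(size_enumeration us sE) index_mem -(mem_enumeration _ sE) (valP e).
by rewrite ffunE val_insubd lt.
Qed.

Lemma rank_in_ordering s : uniq s -> [set x in s] = E ->
  rank_in s \in edge_orderings E.
Proof.
move=> us sE; rewrite inE; apply/andP; split.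
  apply/injectiveP => e e' /(congr1 val); rewrite !rank_inE // => eq.
  by apply/val_inj/(index_inj finset.set0 _ _ eq);
    rewrite -(mem_enumeration _ sE) ?(valP e) ?(valP e').
apply/forallP => k.
have ks : (k < size s)%N by rewrite (size_enumeration us sE).
have kE : tnth (in_tuple s) (Ordinal ks) \in E.
  by rewrite (mem_enumeration _ sE) mem_tnth.
apply/codomP; exists (exist (fun e => e \in E) _ kE : edge E); apply/val_inj.
by rewrite rank_inE //= (tnth_nth finset.set0) index_uniq.
Qed.

Lemma rank_in_inj s s' : uniq s -> uniq s' -> [set x in s] = E ->
  [set x in s'] = E -> rank_in s = rank_in s' -> s = s'.
Proof.
move=> us us' sE sE' eq.
have sz : size s = size s' by rewrite !size_enumeration.
apply: (@eq_from_nth _ finset.set0) => // i si.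
have iE : nth finset.set0 s i \in E by rewrite (mem_enumeration _ sE) mem_nth.
have := rank_inE (exist (fun e => e \in E) _ iE) us sE.
rewrite eq rank_inE //= index_uniq // => idx.
by rewrite -[in RHS]idx nth_index // -(mem_enumeration _ sE').
Qed.

(** An upper bound suffices, as this cardinal serves as a denominator. *)
Lemma card_edge_orderings_le : (#|edge_orderings E| <= #|E| `!)%N.
Proof.
have cE : #|{: edge E}| = #|E| by rewrite card_sig; apply: eq_card => x; rewrite inE.
have : (#|edge_orderings E| <= #|[set f : {ffun edge E -> 'I_#|E|} | injectiveb f]|)%N.
  by apply/subset_leq_card/fintype.subsetP => f; rewrite !inE => /andP[].
by move=> /leq_trans; apply; rewrite card_inj_ffuns card_ord cE ffactnn.
Qed.

Lemma sorted_index (T : eqType) (s : seq T) : uniq s ->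
  sorted (fun x y => (index x s < index y s)%N) s.
Proof.
case: s => [//|x0 s] us; apply/(sortedP x0) => i si.
by rewrite !index_uniq // ltnW.
Qed.

Lemma increasing_trail_rank_in s v : uniq s -> [set x in s] = E ->
  subseq (walk_edges v) s -> increasing_trail (rank_in s) v.
Proof.
move=> us sE sub; have allE : all (fun e => e \in E) (walk_edges v).
  by apply/allP => e /(mem_subseq sub); rewrite (mem_enumeration _ sE).
rewrite /increasing_trail /is_trail allE (subseq_uniq sub us) /=.
have ws : map val (pmap insub (walk_edges v) : seq (edge E)) = walk_edges v.
  rewrite -[RHS](all_filterP allE); elim: (walk_edges v) => [//|e w IH] /=.
  by case: insubP => [u -> ve|/negbTE ->] //=; rewrite IH ve.
have : sorted (fun x y => (index x s < index y s)%N)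
    (map val (pmap insub (walk_edges v) : seq (edge E))).
  by rewrite ws; apply: subseq_sorted sub (sorted_index us) => ? ? ?; exact: ltn_trans.
rewrite sorted_map; apply: sub_sorted => e e' /=.
by rewrite !rank_inE.
Qed.

Lemma longest_rank_in k s : uniq s -> [set x in s] = E ->
  tips k s != finset.set0 -> (k <= longest_increasing_trail (rank_in s))%N.
Proof.
move=> us sE /set0Pn[w /tipsP[x [v [sz _ sub]]]].
have kE : (k < #|E|.+1)%N.
  rewrite ltnS -(size_enumeration us sE) -sz -(size_pairmap (fun y z => [set y; z]) x v).
  exact: size_subseq.
have szv : size (x :: v) == k.+1 by rewrite /= sz.
apply: (leq_trans _ (leq_bigmax_cond (Ordinal kE) _)) => //=.
by apply/existsP; exists (Tuple szv); apply: increasing_trail_rank_in.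
Qed.

End Orderings.

(** * Reduction of the random graph to drawn sequences *)

Section Bridge.
Context (R : realType).

Lemma gnp_massE n (p : R) (E : {set {set 'I_n}}) : E \subset pairs n ->
  gnp_mass p E = p ^+ #|E| * (1 - p) ^+ ('C(n, 2) - #|E|).
Proof.
move=> sE; rewrite /gnp_mass (bigID (mem E)) /=; congr (_ * _).
  rewrite (eq_bigr (fun=> p)) => [|e /andP[_ ->] //].
  rewrite prodr_const; congr (_ ^+ _); apply: eq_card => e.
  by apply: andb_idl; exact: (fintype.subsetP sE).
rewrite (eq_bigr (fun=> 1 - p)) => [|e /andP[_ /negbTE ->] //].
rewrite prodr_const -card_pairs -cardsDS //; congr (_ ^+ _).
by apply: eq_card => e; rewrite finset.in_setD andbC.
Qed.

(** Double count of drawn sequences by their set of entries; [inord] merely turns a cardinal into a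
    summation index. *)
Lemma sum_draw_seqs_by_support (T : finType) (U : {set T}) (phi : seq T -> R)
    (H : nat -> R) :
  \sum_(E in powerset U) H #|E| *
     (\sum_(s <- draw_seqs U #|E| | [set x in s] == E) phi s) =
  \sum_(m < #|U|.+1) H m * (\sum_(s <- draw_seqs U m) phi s).
Proof.
rewrite (partition_big (fun E : {set T} => inord #|E| : 'I_#|U|.+1) predT) //=.
apply: eq_bigr => m _.
rewrite [in RHS]big_seq_cond.
rewrite (partition_big (fun s => [set x in s])
   (fun E : {set T} => (E \in powerset U) && (inord #|E| == m))) /=; last first.
  move=> s; rewrite andbT mem_draw_seqs => /andP[/andP[us /allP sU] /eqP sz].
  have -> : #|[set x in s]| = m.
    by rewrite -sz -(card_uniqP us); apply: eq_card => x; rewrite inE.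
  rewrite inord_val eqxx andbT powersetE; apply/fintype.subsetP => x.
  by rewrite inE => /sU.
rewrite mulr_sumr; apply: eq_bigr => E /andP[]; rewrite powersetE => EU /eqP mE.
have -> : #|E| = m by rewrite -mE inordK // ltnS subset_leq_card.
by congr (_ * _); rewrite big_seq_cond; apply: eq_bigl => s; rewrite andbT.
Qed.

(** Given its number m of edges, the ordered graph is a uniform sequence of m distinct pairs. For a
    lower bound it is enough that distinct good sequences give distinct good orderings. *)
Lemma gnp_ordering_prob_ge n (p : R) (phi : pred (seq {set 'I_n}))
    (A : forall E : {set {set 'I_n}}, pred {ffun edge E -> 'I_#|E|}) :
    0 <= p <= 1 ->
    (forall (E : {set {set 'I_n}}) s, uniq s -> [set x in s] = E -> phi s ->
       A E (rank_in E s)) ->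
  \sum_(m < 'C(n, 2).+1) p ^+ m * (1 - p) ^+ ('C(n, 2) - m) * 'C('C(n, 2), m)%:R *
     draws (pairs n) m (fun s => (phi s)%:R) [::]
  <= gnp_ordering_prob p A.
Proof.
move=> /andP[p0 p1] phiA; set N := 'C(n, 2).
(* Probability of one graph with m edges in one given order. *)
pose H m : R := p ^+ m * (1 - p) ^+ (N - m) / m`!%:R.
apply: (@le_trans _ _ (\sum_(E in powerset (pairs n)) H #|E| *
   (\sum_(s <- draw_seqs (pairs n) #|E| | [set x in s] == E) (phi s)%:R))).
  rewrite sum_draw_seqs_by_support card_pairs -/N; apply: ler_sum => m _.
  have mN : (m <= #|pairs n|)%N by rewrite card_pairs -ltnS ltn_ord.
  rewrite -draws_sum_seqs // card_pairs -/N /H -bin_ffact natrM.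
  rewrite le_eqVlt; apply/orP; left; apply/eqP; field.
  by rewrite pnatr_eq0 -lt0n fact_gt0.
apply: ler_sum => E; rewrite powersetE => EU.
rewrite gnp_massE // /H -[leLHS]mulrA ler_wpM2l ?mulr_ge0 ?exprn_ge0 ?subr_ge0 //.
rewrite mulrC ler_pM ?invr_ge0 ?sumr_ge0 //.
  rewrite -natr_sum ler_nat -big_mkcondr /= -big_filter.
  set r := [seq i <- _ | _].
  have rP s : s \in r -> [/\ uniq s, [set x in s] = E & phi s].
    rewrite mem_filter mem_draw_seqs => /andP[/andP[/eqP sE ph] /andP[/andP[us _] _]].
    by [].
  rewrite sum1_size -(size_map (rank_in E)) -(card_uniqP _).
    apply/subset_leq_card/fintype.subsetP => f /mapP[s /rP[us sE ph] ->].
    by rewrite inE rank_in_ordering //=; apply: phiA.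
  rewrite map_inj_in_uniq ?filter_uniq ?uniq_draw_seqs //.
  by move=> s s' /rP[us sE _] /rP[us' sE' _]; exact: rank_in_inj.
rewrite lef_pV2 ?posrE ?ltr0n ?fact_gt0 ?ler_nat ?card_edge_orderings_le //.
rewrite card_gt0; apply/set0Pn; exists (rank_in E (enum E)).
by rewrite rank_in_ordering ?enum_uniq //; apply/setP => e; rewrite inE mem_enum.
Qed.

End Bridge.

(** * Lower tail of the number of edges *)

Section Binomial.
Context (R : realType).
Implicit Types (p z : R) (N m : nat).

Definition binomial_mass N p m : R := p ^+ m * (1 - p) ^+ (N - m) * 'C(N, m)%:R.

Lemma binomial_mass_ge0 N p m : 0 <= p <= 1 -> 0 <= binomial_mass N p m.
Proof. by case/andP=> p0 p1; rewrite !mulr_ge0 ?exprn_ge0 ?subr_ge0. Qed.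

Lemma sum_binomial_mass N p z :
  \sum_(m < N.+1) binomial_mass N p m * z ^+ m = (1 - p + p * z) ^+ N.
Proof.
rewrite exprDn; apply: eq_bigr => m _.
by rewrite /binomial_mass -mulr_natr exprMn; ring.
Qed.

Lemma sum_binomial_mass1 N p : \sum_(m < N.+1) binomial_mass N p m = 1.
Proof.
have := sum_binomial_mass N p 1; rewrite mulr1 subrK expr1n => <-.
by apply: eq_bigr => m _; rewrite expr1n mulr1.
Qed.

(** Chernoff's bound: the weight exp(z (m0 - m)) is at least 1 on the tail, and z (1 - 2 z) - (z -
    z^2) = - z^2 is the exponent per unit of mean. *)
Lemma binomial_lower_tail N p m0 z : 0 <= p <= 1 -> 0 <= z <= 3^-1 ->
    m0%:R <= (1 - 2 * z) * (N%:R * p) ->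
  \sum_(m < N.+1 | (m < m0)%N) binomial_mass N p m <= expR (- (z ^+ 2 * (N%:R * p))).
Proof.
move=> p01 /andP[z0 z1] m0le; have /andP[p0 p1] := p01.
have y1 : expR (- z) <= 1 - (z - z ^+ 2).
  have := @expR_le_quadratic R (- z); rewrite normrN ger0_norm // sqrrN.
  by move=> /(_ z1); lra.
apply: (@le_trans _ _ (\sum_(m < N.+1)
   expR (z * m0%:R) * (binomial_mass N p m * expR (- z) ^+ m))).
  rewrite [leLHS]big_mkcond /=; apply: ler_sum => m _.
  have b0 := binomial_mass_ge0 N m p01.
  case: ifP => [lt|_]; last by rewrite mulr_ge0 ?expR_ge0 // mulr_ge0 // exprn_ge0 // expR_ge0.
  rewrite mulrCA -expRM_natl -expRD -[leLHS]mulr1 ler_wpM2l //.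
  rewrite -[leLHS]expR0 ler_expR.
  have : 0 <= z * (m0%:R - m%:R) by rewrite mulr_ge0 // subr_ge0 ler_nat ltnW.
  by lra.
rewrite -mulr_sumr sum_binomial_mass.
apply: (@le_trans _ _ (expR (z * m0%:R) * expR (- (p * (z - z ^+ 2))) ^+ N)).
  rewrite ler_wpM2l ?expR_ge0 // lerXn2r ?nnegrE ?expR_ge0 //.
    by rewrite addr_ge0 ?subr_ge0 ?mulr_ge0 ?expR_ge0.
  apply: le_trans (expR_ge1Dx _).
  have : p * expR (- z) <= p * (1 - (z - z ^+ 2)) by rewrite ler_wpM2l.
  by lra.
rewrite -expRM_natl -expRD ler_expR.
have : z * m0%:R <= z * ((1 - 2 * z) * (N%:R * p)) by rewrite ler_wpM2l.
by lra.
Qed.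

End Binomial.

(** * Probability bounds for the ordered random graph *)

Section GnpBounds.
Context (R : realType) (n : nat) (p : R).
Context (A : forall E : {set {set 'I_n}}, pred {ffun edge E -> 'I_#|E|}).
Context (p01 : 0 <= p <= 1).

(** Serves the upper side of the convergence to 1. *)
Lemma gnp_ordering_prob_le1 : gnp_ordering_prob p A <= 1.
Proof.
have /andP[p0 p1] := p01.
rewrite -(sum_binomial_mass1 'C(n, 2) p).
apply: (@le_trans _ _ (\sum_(E in powerset (pairs n)) gnp_mass p E)).
  apply: ler_sum => E; rewrite powersetE => EU.
  rewrite ler_piMr ?gnp_massE ?mulr_ge0 ?exprn_ge0 ?subr_ge0 //.
  have [no_ord|ord_gt0] := posnP #|edge_orderings E|; first by rewrite no_ord invr0 mulr0.
  rewrite ler_pdivrMr ?ltr0n // mul1r ler_nat.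
  by apply/subset_leq_card/fintype.subsetP => f; rewrite inE => /andP[].
rewrite (partition_big (fun E : {set {set 'I_n}} => inord #|E| : 'I_('C(n, 2).+1))
  predT) //=.
apply: ler_sum => m _.
rewrite (eq_bigr (fun=> p ^+ m * (1 - p) ^+ ('C(n, 2) - m))) => [|E]; last first.
  rewrite powersetE => /andP[EU /eqP <-]; rewrite gnp_massE // inordK //.
  by rewrite ltnS -card_pairs subset_leq_card.
rewrite sumr_const -[leLHS]mulr_natr /binomial_mass ler_wpM2l //.
  by rewrite mulr_ge0 ?exprn_ge0 ?subr_ge0.
rewrite ler_nat.
rewrite -[X in (_ <= X)%N](congr1 (fun N => binomial N m) (card_pairs n)) -cards_draws.
apply/subset_leq_card/fintype.subsetP => E /andP[]; rewrite powersetE => EU /eqP mE.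
have Em : #|E| = m by rewrite -mE inordK // ltnS -card_pairs subset_leq_card.
by rewrite inE EU Em eqxx.
Qed.

(** Tips are never lost; m must not exceed the number of pairs, beyond which [draws] is 0. *)
Lemma draws_tips_mono k m0 m : (m0 <= m <= 'C(n, 2))%N ->
  draws (pairs n) m0 (fun t => (tips k t != finset.set0)%:R) [::]
  <= draws (pairs n) m (fun t => (tips k t != finset.set0)%:R) [::] :> R.
Proof.
move=> /andP[m0m mN]; rewrite -(subnKC m0m) drawsD.
apply: draws_le_in => // t dt st _.
have tm : (size t + (m - m0) <= #|pairs n|)%N.
  by rewrite st /= add0n subnKC // card_pairs.
rewrite -[leLHS](draws_const _ dt tm).
apply: draws_le_in => // u _ _ tu; rewrite ler_nat.
have [/set0Pn[w wt]|//] := boolP (tips k t != _).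
by rewrite lt0b; apply/set0Pn; exists w; exact: (fintype.subsetP (tips_prefix k tu)).
Qed.

(** Outside the binomial tail at least m0 edges appear, and the first m0 already give a tip with
    probability W; since W <= 1, discarding the tail costs at most its mass. *)
Lemma gnp_tips_ge k m0 (z : R) : 0 <= z <= 3^-1 ->
    m0%:R <= (1 - 2 * z) * ('C(n, 2)%:R * p) ->
    (forall (E : {set {set 'I_n}}) (f : {ffun edge E -> 'I_#|E|}),
       (k <= longest_increasing_trail f)%N -> A f) ->
  draws (pairs n) m0 (fun t => (tips k t != finset.set0)%:R) [::]
    - expR (- (z ^+ 2 * ('C(n, 2)%:R * p))) <= gnp_ordering_prob p A.
Proof.
move=> zb m0le kA.
apply: le_trans (gnp_ordering_prob_ge (phi := fun s => tips k s != finset.set0) p01 _);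
  last by move=> E s us sE ts; apply/kA/longest_rank_in.
set W := draws _ _ _ _.
have W1 : W <= 1.
  apply: le_trans (draws_const_le m0 ler01 (draw_seq_nil (pairs n))).
  by apply: draws_le => // t; case: (_ != _).
have W0 : 0 <= W by apply: draws_ge0.
have tail := binomial_lower_tail p01 zb m0le.
apply: (@le_trans _ _ (\sum_(m < 'C(n, 2).+1 | ~~ (m < m0)%N) binomial_mass 'C(n, 2) p m * W)).
  rewrite -mulr_suml.
  have := sum_binomial_mass1 'C(n, 2) p.
  rewrite (bigID (fun m : 'I_ _ => (m < m0)%N)) /=.
  set a := \sum_(_ < _ | _) _ in tail *; set b := \sum_(_ < _ | _) _ => ab.
  have a0 : 0 <= a by apply: sumr_ge0 => m _; exact: binomial_mass_ge0.
  have aW : a * W <= a * 1 by rewrite ler_wpM2l.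
  have -> : b = 1 - a by rewrite -ab; ring.
  by lra.
rewrite big_mkcond /=; apply: ler_sum => m _.
case: ifP => [|_]; last by rewrite mulr_ge0 ?binomial_mass_ge0 // draws_ge0.
rewrite -leqNgt => m0m; rewrite ler_wpM2l ?binomial_mass_ge0 //.
by apply: draws_tips_mono; rewrite m0m -ltnS ltn_ord.
Qed.

End GnpBounds.

(** * Stirling's bound and the shape of a chunk *)

Section ChunkParameters.
Context (R : realType).

(** A weak Stirling bound; the induction step is (1 + 1/k)^(k+1) >= [expR 1]. *)
Lemma fact_expR_le l : (0 < l)%N ->
  (l`!)%:R * expR 1 ^+ l <= expR 1 * l%:R ^+ l.+1 :> R.
Proof.
elim: l => [//|[|l] IH] _; first by rewrite !expr1 factE mul1r expr1n mulr1.
have {}IH := IH (ltn0Sn l); set k := l.+1 in IH *.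
have k0 : 0 < k%:R :> R by rewrite ltr0n.
have step : expR 1 * k%:R ^+ k.+1 <= k.+1%:R ^+ k.+1 :> R.
  have -> : expR 1 = expR (k.+1%:R^-1) ^+ k.+1 :> R.
    by rewrite -expRM_natl mulfV // pnatr_eq0.
  rewrite -exprMn lerXn2r ?nnegrE ?mulr_ge0 ?expR_ge0 //.
  have h : k%:R / k.+1%:R <= expR (- k.+1%:R^-1) :> R.
    apply: le_trans (expR_ge1Dx _).
    rewrite -[k.+1%:R in leLHS]natr1 -natr1 le_eqVlt; apply/orP; left.
    by apply/eqP; field; rewrite gt_eqF // ltr_wpDl.
  rewrite -ler_pdivlMl ?expR_gt0 // -expRN.
  by move: h; rewrite ler_pdivrMr ?ltr0n.
rewrite factS natrM exprS mulrACA.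
apply: (@le_trans _ _ (k.+1%:R * expR 1 * (expR 1 * k%:R ^+ k.+1))).
  by rewrite ler_wpM2l ?mulr_ge0 ?expR_ge0.
apply: (@le_trans _ _ (k.+1%:R * expR 1 * k.+1%:R ^+ k.+1)).
  by rewrite ler_wpM2l ?mulr_ge0 ?expR_ge0.
by rewrite -mulrA [leLHS]mulrCA -exprS.
Qed.

Lemma expn_le_ffact K l j : (j <= l <= K)%N -> ((K - l) ^ j <= K ^_ j)%N.
Proof.
elim: j => [//|j IH] /andP[jl lK].
rewrite expnSr ffactnSr leq_mul ?IH ?(ltnW jl) // leq_sub2l //.
exact: ltnW.
Qed.

Lemma bernoulli_sub (u : R) l : 0 <= u <= 1 -> 1 - l%:R * u <= (1 - u) ^+ l.
Proof.
move=> /andP[u0 u1]; elim: l => [|l IH]; first by rewrite mul0r subr0.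
rewrite exprS; apply: (@le_trans _ _ ((1 - u) * (1 - l%:R * u))).
  rewrite -natr1; have : 0 <= l%:R * u * u by rewrite !mulr_ge0.
  by lra.
by rewrite ler_wpM2l // subr_ge0.
Qed.

(** With K = 2 l^2, the falling factorial is at least (K - l)^l, and Bernoulli gives (1 - l/K)^l >=
    1 - l^2/K = 1/2. *)
Lemma bin_double_square_ge l : (0 < l)%N ->
  ((2 * l ^ 2) ^ l)%:R / (2 * l`!%:R) <= 'C(2 * l ^ 2, l)%:R :> R.
Proof.
move=> l0; set K := (2 * l ^ 2)%N.
have lK : (l <= K)%N by rewrite /K; nia.
have K0 : 0 < K%:R :> R by rewrite ltr0n; exact: leq_trans lK.
have f0 : 0 < (l`!)%:R :> R by rewrite ltr0n fact_gt0.
rewrite ler_pdivrMr ?mulr_gt0 // mulrCA -natrM bin_ffact.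
apply: (@le_trans _ _ (2 * ((K - l) ^ l)%:R)); last first.
  by rewrite ler_wpM2l // ler_nat expn_le_ffact // leqnn lK.
have lK1 : l%:R / K%:R <= 1 :> R by rewrite ler_pdivrMr // mul1r ler_nat.
have u01 : 0 <= (l%:R : R) / K%:R <= 1 by rewrite lK1 divr_ge0.
have := bernoulli_sub l u01.
have -> : l%:R * (l%:R / K%:R) = 2^-1 :> R.
  rewrite /K natrM natrX; field.
  by rewrite pnatr_eq0 -lt0n.
have -> : 1 - l%:R / K%:R = (K - l)%:R / K%:R :> R.
  by rewrite natrB // mulrBl mulfV // gt_eqF.
rewrite expr_div_n ler_pdivlMr ?exprn_gt0 // -!natrX.
by lra.
Qed.

Lemma chunk_parameters (e : R) : 0 < e <= 4^-1 ->
  exists l K (x : R), [/\ (0 < l)%N, (0 < K)%N, 0 < x <= 1,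
    1 <= 'C(K, l)%:R * x ^+ l & l%:R = (1 - e) * expR 1 * K%:R * x].
Proof.
move=> /andP[e0 e4]; set E : R := expR 1.
have E2 : 2 <= E by apply: le_trans (expR_ge1Dx 1); lra.
(* This l satisfies (l e)^2 / 2 >= 2 E l, so exp(e l) outweighs the polynomial factor lost in
   Stirling's bound. *)
pose l := (Num.trunc (4 * E / e ^+ 2)).+1; pose K := (2 * l ^ 2)%N.
have l0 : (0 < l)%N by [].
have l1 : 1 <= l%:R :> R by rewrite ler1n.
have ll : 4 * E <= l%:R * e ^+ 2.
  by rewrite -ler_pdivrMr ?exprn_gt0 // ltW // truncnS_gt.
have K0 : (0 < K)%N by rewrite /K; nia.
have KR : K%:R = 2 * l%:R ^+ 2 :> R by rewrite /K natrM natrX.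
have e1 : 0 < 1 - e by lra.
have q0 : 0 < (1 - e) * E * K%:R.
  by rewrite mulr_gt0 ?ltr0n // mulr_gt0 // expR_gt0.
(* x is forced by the last equation; then C(K, l) x^l is at least 1 / (2 E l (1 - e)^l). *)
exists l, K, (l%:R / ((1 - e) * E * K%:R)); split=> //; last first.
- by rewrite mulrC divfK // gt_eqF.
- have decay : (1 - e) ^+ l * (2 * E * l%:R) <= 1.
    apply: (@le_trans _ _ (expR (- e) ^+ l * (2 * E * l%:R))).
      rewrite ler_wpM2r ?mulr_ge0 ?expR_ge0 // lerXn2r ?nnegrE ?expR_ge0 ?(ltW e1) //.
      by apply: expR_ge1Dx.
    rewrite -expRM_natl mulrN expRN mulrC ler_pdivrMr ?expR_gt0 // mul1r.
    have le0 : 0 <= l%:R * e by rewrite mulr_ge0 // ltW.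
    apply: le_trans (expR_ge1Dxn 1 le0).
    have : l%:R * (4 * E) <= l%:R * (l%:R * e ^+ 2) by rewrite ler_wpM2l.
    by rewrite exprMn (_ : 2`!%:R = 2) //; lra.
  have f0 : 0 < (l`!)%:R :> R by rewrite ltr0n fact_gt0.
  apply: (@le_trans _ _ ((K ^ l)%:R / (2 * l`!%:R) * (l%:R / ((1 - e) * E * K%:R)) ^+ l)).
    have Kl0 : 0 < K%:R ^+ l :> R by rewrite exprn_gt0 // ltr0n.
    have el0 : 0 < (1 - e) ^+ l by rewrite exprn_gt0.
    have El0 : 0 < E ^+ l by rewrite exprn_gt0 // expR_gt0.
    rewrite natrX expr_div_n !exprMn.
    have -> : K%:R ^+ l / (2 * l`!%:R) * (l%:R ^+ l / ((1 - e) ^+ l * E ^+ l * K%:R ^+ l))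
      = l%:R ^+ l / (2 * ((l`!)%:R * E ^+ l) * (1 - e) ^+ l).
      by field; rewrite !gt_eqF.
    rewrite ler_pdivlMr ?mulr_gt0 // mul1r.
    apply: (@le_trans _ _ (2 * (E * l%:R ^+ l.+1) * (1 - e) ^+ l)).
      by rewrite ler_wpM2r ?(ltW el0) // ler_wpM2l // fact_expR_le.
    rewrite exprS.
    have -> : 2 * (E * (l%:R * l%:R ^+ l)) * (1 - e) ^+ l =
      l%:R ^+ l * ((1 - e) ^+ l * (2 * E * l%:R)) by ring.
    by rewrite ler_piMr ?exprn_ge0.
  by rewrite ler_wpM2r ?bin_double_square_ge // exprn_ge0 // divr_ge0 // ltW.
rewrite divr_gt0 ?ltr0n //= ler_pdivrMr // mul1r KR.
have h1 : l%:R <= l%:R ^+ 2 :> R by rewrite expr2; nra.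
have h2 : 1 <= (1 - e) * E by nra.
have : 0 <= l%:R ^+ 2 * ((1 - e) * E - 1) by rewrite mulr_ge0 ?subr_ge0 ?sqr_ge0.
by nra.
Qed.

End ChunkParameters.

(** * Numerical estimates for blocks and chunks *)

(** Verifies [gain_ok] with z = e/4 and x = (1 - e) eta. The margin is (1 - e/4)^2 - (1 - e) >= e/2,
    times z eta T. *)
Lemma gain_estimate (R : realFieldType) (n e eta L T mu C : R) :
    0 < n -> 0 < e <= 4^-1 -> 0 < eta -> 16 <= n * e -> 0 < C ->
    C <= n ^+ 2 / 2 -> 0 <= mu -> mu * n <= T -> eta * n / 2 <= L ->
  e / 4 * ((1 - e) * eta * T) -
    L * ((T * (n - 2 * (e / 16 * n) - 1) / C - 2 * (e / 16) * mu)
         * (e / 4 - (e / 4) ^+ 2)) <= - (e ^+ 2 / 8 * eta * mu * n).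
Proof.
move=> n0 /andP[e0 e4] eta0 ne C0 Cn mu0 muT Ln.
have T0 : 0 <= T by apply: le_trans muT; rewrite mulr_ge0 // ltW.
have n1 : n != 0 by rewrite gt_eqF.
(* Relative losses are 2e/16 from M, e/16 from the 1 (as 16 <= n e) and, in [h3], e/16 from the
   density error: e/4 in all. *)
have h1 : T * (n * (1 - 3 * (e / 16))) <= T * (n - 2 * (e / 16 * n) - 1).
  by rewrite ler_wpM2l //; lra.
have h0 : 0 <= T * (n * (1 - 3 * (e / 16))).
  by rewrite mulr_ge0 // mulr_ge0 ?(ltW n0) //; lra.
have h2 : 2 * T / n * (1 - 3 * (e / 16)) <= T * (n - 2 * (e / 16 * n) - 1) / C.
  rewrite ler_pdivlMr //; apply: le_trans h1.
  apply: (@le_trans _ _ (2 * T / n * (1 - 3 * (e / 16)) * (n ^+ 2 / 2))).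
    rewrite ler_wpM2l // mulr_ge0 //; last by lra.
    by rewrite divr_ge0 ?(ltW n0) // mulr_ge0.
  by rewrite le_eqVlt; apply/orP; left; apply/eqP; field.
have h3 : 2 * (e / 16) * mu <= 2 * T / n * (e / 16).
  rewrite [leRHS]mulrAC ler_pdivlMr //.
  have : 0 <= e * (T - mu * n) by rewrite mulr_ge0 ?subr_ge0 // ltW.
  by lra.
have w0 : 0 <= 2 * T / n by rewrite divr_ge0 ?(ltW n0) // mulr_ge0.
set B := _ / C - _.
have hB : 2 * T / n * (1 - e / 4) <= B by rewrite /B; lra.
have hL : eta * T * (1 - e / 4) <= L * B.
  apply: (@le_trans _ _ (eta * n / 2 * (2 * T / n * (1 - e / 4)))).
    by rewrite le_eqVlt; apply/orP; left; apply/eqP; field.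
  rewrite ler_pM //; first by rewrite divr_ge0 // mulr_ge0 // ltW.
  by rewrite mulr_ge0 //; lra.
have zz : 0 <= e / 4 - (e / 4) ^+ 2 by nra.
have hLz : eta * T * (1 - e / 4) * (e / 4 - (e / 4) ^+ 2)
    <= L * B * (e / 4 - (e / 4) ^+ 2) by rewrite ler_wpM2r.
rewrite mulrA.
have wT : eta * (mu * n) <= eta * T by rewrite ler_wpM2l // ltW.
have s1 : 0 <= e ^+ 2 * (eta * T - eta * (mu * n)).
  by rewrite mulr_ge0 ?sqr_ge0 // subr_ge0.
have s2 : 0 <= e ^+ 3 * (eta * T).
  by rewrite mulr_ge0 ?exprn_ge0 ?(ltW e0) // mulr_ge0 // ltW.
by nra.
Qed.

(** The loss 6 e is made of 2 e from the edge count, 2 e from (1 - e)^2, e from rounding L, and e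
    from the additive terms, incomplete last chunk included. *)
Lemma chunk_count_estimate (R : realFieldType) (n p e eta E K L l c m : R) :
    2 <= n -> 0 <= p <= 1 -> 0 < e <= 4^-1 -> 0 < eta -> 0 <= K -> 0 <= l ->
    0 <= c -> 0 <= E ->
    l = (1 - e) ^+ 2 * E * K * eta -> L <= eta * n / 2 + 1 -> 2 <= e * eta * n ->
    (1 - 2 * e) * (n * (n - 1) / 2 * p) - 1 <= m -> m <= (c + 1) * (K * L) ->
    2 * E + 2 * l <= e * E * (n * p) ->
  (1 - 6 * e) * E * (n * p) <= c * l.
Proof.
move=> n2 /andP[p0 p1] /andP[e0 e4] eta0 K0 l0 c0 E0 lE Ln en mlo mhi big.
have L1 : L <= eta * n / 2 * (1 + e) by lra.
have h1 : (1 - 2 * e) * (n * (n - 1) / 2 * p) - 1 <= (c + 1) * (K * (eta * n / 2 * (1 + e))).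
  apply: le_trans mlo (le_trans mhi _).
  by rewrite ler_wpM2l ?addr_ge0 // ler_wpM2l.
have h2 : (1 - 2 * e) * (n * p) - 2 <= (c + 1) * (K * eta) * (1 + e).
  have n0 : 0 < n / 2 by lra.
  rewrite -(ler_pM2l n0).
  have ep : 0 <= (1 - 2 * e) * p by rewrite mulr_ge0 //; lra.
  have ep1 : (1 - 2 * e) * p <= 1 by nra.
  have : (1 - 2 * e) * p * n <= n by nra.
  by lra.
have E1 : 0 <= (1 - e) ^+ 2 * E by rewrite mulr_ge0 ?sqr_ge0.
have h3 : (1 - e) ^+ 2 * E * ((1 - 2 * e) * (n * p) - 2) <= (c + 1) * l * (1 + e).
  rewrite lE; apply: le_trans (ler_wpM2l E1 h2) _.
  by rewrite le_eqVlt; apply/orP; left; apply/eqP; ring.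
have y0 : 0 <= n * p by rewrite mulr_ge0 //; lra.
have Ey : 0 <= E * (n * p) by rewrite mulr_ge0.
have q : 1 - 4 * e <= (1 - e) ^+ 2 * (1 - 2 * e) by nra.
have h4 : (1 - 4 * e) * (E * (n * p)) <= (1 - e) ^+ 2 * (1 - 2 * e) * (E * (n * p)).
  by rewrite ler_wpM2r.
have h5 : (1 - e) ^+ 2 * E <= E.
  by rewrite ler_piMl //; nra.
have h6 : l * e <= l by nra.
have h7 : (1 - 5 * e) * (E * (n * p)) <= c * l * (1 + e) by lra.
have e1 : 0 < 1 + e by lra.
rewrite -(ler_pM2r e1); apply: le_trans h7.
have : 0 <= e ^+ 2 * (E * (n * p)) by rewrite mulr_ge0 ?sqr_ge0.
by lra.
Qed.

(** * Choice of constants and conclusion *)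

Section MainTheorem.
Context (R : realType).

Lemma bin2R n : 'C(n, 2)%:R = n%:R * (n%:R - 1) / 2 :> R.
Proof.
apply: (@mulIf _ (2 : R)) => //; rewrite divfK //.
rewrite (_ : 2 = (2`!)%:R) // -natrM bin_ffact.
case: n => [|n]; first by rewrite mul0r.
by rewrite ffactnS ffactn1 natrM /= -[n.+1%:R in RHS]natr1 addrK natr1.
Qed.

Lemma sqr_expRN_le (lam n : R) : 0 < lam -> 0 < n ->
  n ^+ 2 * expR (- (lam * n)) <= 6 / (lam ^+ 3 * n).
Proof.
move=> lam0 n0; have ln0 : 0 < lam * n by rewrite mulr_gt0.
have := expR_ge1Dxn 2 (ltW ln0); rewrite (_ : 3`!%:R = 6) // => lo.
rewrite ler_pdivlMr ?mulr_gt0 ?exprn_gt0 // expRN mulrAC ler_pdivrMr ?expR_gt0 //.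
have -> : n ^+ 2 * (lam ^+ 3 * n) = (lam * n) ^+ 3 by ring.
by lra.
Qed.

(** Since (th/D)^2 = e^2 d^2, the exponent is at most - e^2 d^2 C(n, 2) <= - 3 n, while 4^n <= exp(2
    n). *)
Lemma exp_decay_vs_4n n m (e d : R) : 0 < e -> 0 < d ->
    (2 <= n)%N -> 6 / (e ^+ 2 * d ^+ 2) <= n%:R - 1 -> (m <= 'C(n, 2))%N ->
  m%:R * (4 ^ n)%:R * expR (m%:R * ((2 * e ^+ 2 * d * 'C(n, 2)%:R) ^+ 2 /
     (2 * e * 'C(n, 2)%:R) ^+ 2) - 2 * e ^+ 2 * d * 'C(n, 2)%:R * d) <= 6 / n%:R :> R.
Proof.
move=> e0 d0 n2 nbig mN; have N0 : 0 < 'C(n, 2)%:R :> R by rewrite ltr0n bin_gt0.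
have n0 : 0 < n%:R :> R by rewrite ltr0n; exact: leq_trans n2.
have n1 : 1 <= n%:R :> R by rewrite ler1n; exact: leq_trans n2.
have -> : (2 * e ^+ 2 * d * 'C(n, 2)%:R) ^+ 2 / (2 * e * 'C(n, 2)%:R) ^+ 2 =
    e ^+ 2 * d ^+ 2 by field; rewrite !gt_eqF.
have ed0 : 0 < e ^+ 2 * d ^+ 2 by rewrite mulr_gt0 // exprn_gt0.
have mR : m%:R <= 'C(n, 2)%:R :> R by rewrite ler_nat.
have := sqr_expRN_le (@ltr01 R) n0; rewrite expr1n !mul1r; apply: le_trans.
have four : 4 ^+ n <= expR (n%:R * 2) :> R.
  rewrite expRM_natl lerXn2r ?nnegrE ?expR_ge0 //.
  have -> : (2 : R) = 1 + 1 by ring.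
  have E2 : 2 <= expR 1 :> R by apply: le_trans (expR_ge1Dx 1); lra.
  by rewrite expRD; nra.
rewrite natrX -mulrA ler_pM // ?mulr_ge0 ?exprn_ge0 ?expR_ge0 //.
  apply: le_trans mR _; rewrite bin2R.
  have : 0 <= n%:R * (n%:R + 1) :> R by rewrite mulr_ge0 // addr_ge0.
  by lra.
apply: (@le_trans _ _ (expR (n%:R * 2) * expR (- (e ^+ 2 * d ^+ 2 * 'C(n, 2)%:R)))).
  rewrite ler_pM ?exprn_ge0 ?expR_ge0 // ler_expR.
  have : m%:R * (e ^+ 2 * d ^+ 2) <= 'C(n, 2)%:R * (e ^+ 2 * d ^+ 2) by rewrite ler_wpM2r // ltW.
  by lra.
rewrite -expRD ler_expR bin2R.
have : 6 * n%:R <= (n%:R - 1) * (e ^+ 2 * d ^+ 2) * n%:R.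
  by rewrite ler_pM2r // -ler_pdivrMr.
by lra.
Qed.

Lemma block_error_le (lam n tau c K l : R) : 0 < lam -> 0 < n -> 0 < tau ->
    0 <= K -> 0 <= l -> c <= n ^+ 2 -> 18 * (K * l) / (lam ^+ 3 * tau) <= n ->
  c * (K * (l * expR (- (lam * n)))) <= tau / 3.
Proof.
move=> lam0 n0 tau0 K0 l0 cn nbig.
have Kl0 : 0 <= K * l by rewrite mulr_ge0.
apply: (@le_trans _ _ (K * l * (n ^+ 2 * expR (- (lam * n))))).
  set X := expR _; have -> : c * (K * (l * X)) = K * l * (c * X) by ring.
  by rewrite ler_wpM2l // ler_wpM2r ?expR_ge0.
apply: le_trans (ler_wpM2l Kl0 (sqr_expRN_le lam0 n0)) _.
have l3 : 0 < lam ^+ 3 by rewrite exprn_gt0.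
have l3t : 0 < lam ^+ 3 * tau by exact: mulr_gt0.
have l3n : 0 < lam ^+ 3 * n by exact: mulr_gt0.
move: nbig; rewrite ler_pdivrMr // => h; rewrite mulrA ler_pdivrMr //.
by lra.
Qed.

Lemma tail_error_le (e n p tau : R) : 0 < e -> 0 < tau -> 2 <= n -> 0 <= p ->
    12 / (e ^+ 2 * tau) <= n * p ->
  expR (- (e ^+ 2 * (n * (n - 1) / 2 * p))) <= tau / 3.
Proof.
move=> e0 tau0 n2 p0 big; set u := _ * (_ * p).
have np0 : 0 <= n * p by rewrite mulr_ge0 //; lra.
have e2 : 0 <= e ^+ 2 by exact: sqr_ge0.
have u_ge : e ^+ 2 * (n * p / 4) <= u.
  rewrite ler_wpM2l //.
  have : 0 <= n * p * (n - 2) by rewrite mulr_ge0 // subr_ge0.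
  by lra.
have : 3 / tau <= expR u.
  apply: (le_trans _ (expR_ge1Dx _)); apply: (@le_trans _ _ u); last by rewrite lerDr.
  apply: le_trans u_ge.
  move: big; rewrite ler_pdivrMr ?mulr_gt0 ?exprn_gt0 // ler_pdivrMr //.
  by lra.
rewrite ler_pdivrMr // expRN => h.
by rewrite -[leLHS]mul1r ler_pdivrMr ?expR_gt0 //; lra.
Qed.

(** The threshold depends on eps and tau only. The failure probability is split into three equal
    shares: missed blocks, uneven density, too few edges. *)
Lemma increasing_trail_prob_ge (eps tau : R) : 0 < eps -> 0 < tau ->
  exists y0 : R, forall n (p : R), y0 <= n%:R -> 0 <= p <= 1 -> y0 <= n%:R * p ->
    1 - tau <= gnp_ordering_prob p
     (fun (E : {set {set 'I_n}}) (f : {ffun edge E -> 'I_#|E|}) =>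
        (1 - eps) * expR 1 * n%:R * p <= (longest_increasing_trail f)%:R).
Proof.
move=> eps0 tau0; pose e := Num.min (eps / 6) 4^-1.
have e0 : 0 < e by rewrite lt_min divr_gt0 //= invr_gt0.
have e4 : e <= 4^-1 by rewrite ge_min lexx orbT.
have e6 : 6 * e <= eps.
  have : e <= eps / 6 by rewrite ge_min lexx.
  by lra.
clearbody e; have eb : 0 < e <= 4^-1 by rewrite e0.
have chernoff : 0 <= e <= 3^-1 by lra.
have zb : 0 <= e / 4 <= 3^-1 by lra.
have [l [K [x [l0 K0 /andP[x0 x1] Kl lE]]]] := chunk_parameters eb.
have e1 : 0 < 1 - e by lra.
(* b is chosen so that b n 2^K = e n / 16, the bound M on all targets. *)
pose eta := x / (1 - e); pose b := e / 16 / (2 ^ K)%:R.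
have eta0 : 0 < eta by rewrite divr_gt0.
have xE : x = (1 - e) * eta by rewrite /eta mulrC divfK // gt_eqF.
have K2 : 0 < (2 ^ K)%:R :> R by rewrite ltr0n expn_gt0.
have b0 : 0 < b by rewrite divr_gt0 // divr_gt0.
(* No positive target is below [mu n]; this fixes the tolerable density error d and the rate lam. *)
pose mu := b * x ^+ l; have mu0 : 0 < mu by rewrite mulr_gt0 ?exprn_gt0.
have b1 : b <= 1.
  rewrite ler_pdivrMr // mul1r; apply: (@le_trans _ _ 1); first by lra.
  by rewrite ler1n expn_gt0.
have mu1 : mu <= 1 by rewrite mulr_ile1 ?exprn_ile1 ?exprn_ge0 ?(ltW x0) ?(ltW b0).
pose d := 2 * (e / 16) * mu; have d0 : 0 < d by rewrite mulr_gt0 // mulr_gt0 // divr_gt0.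
have d1 : d <= 1 by rewrite /d; nra.
pose lam := e ^+ 2 / 8 * eta * mu.
have lam0 : 0 < lam by rewrite mulr_gt0 // mulr_gt0 // divr_gt0 ?exprn_gt0.
have l3 : 0 < lam ^+ 3 by rewrite exprn_gt0.
exists (Num.max 2 (Num.max (16 / e) (Num.max (2 / (e * eta))
  (Num.max (18 * (K%:R * l%:R) / (lam ^+ 3 * tau))
  (Num.max (6 / (e ^+ 2 * d ^+ 2) + 1) (Num.max (18 / tau)
  (Num.max ((2 * expR 1 + 2 * l%:R) / (e * expR 1)) (12 / (e ^+ 2 * tau))))))))) => n p.
rewrite !ge_max => /andP[nR2 /andP[nt1 /andP[nt2 /andP[nt3 /andP[nt4 /andP[nt5 _]]]]]].
move=> p01 /andP[_ /andP[_ /andP[_ /andP[_ /andP[_ /andP[_ /andP[nt6 nt7]]]]]]].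
have /andP[p0 p1] := p01.
have n2 : (2 <= n)%N by rewrite -(ler_nat R).
have n0 : 0 < n%:R :> R by lra.
have {}nt1 : 16 <= n%:R * e by rewrite -ler_pdivrMr.
have {}nt2 : 2 <= e * eta * n%:R by rewrite mulrC -ler_pdivrMr // mulr_gt0.
have {}nt4 : 6 / (e ^+ 2 * d ^+ 2) <= n%:R - 1 by rewrite lerBrDr.
set N := 'C(n, 2).
have N0 : 0 < N%:R :> R by rewrite ltr0n bin_gt0.
have NE : N%:R = n%:R * (n%:R - 1) / 2 :> R by exact: bin2R.
have Np0 : 0 <= N%:R * p by rewrite mulr_ge0 // ltW.
pose m0 := Num.trunc ((1 - 2 * e) * (N%:R * p)).
have m0_arg : 0 <= (1 - 2 * e) * (N%:R * p) by rewrite mulr_ge0 //; lra.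
have m0le : m0%:R <= (1 - 2 * e) * (N%:R * p) by rewrite truncn_le.
have m0ge : (1 - 2 * e) * (N%:R * p) - 1 <= m0%:R.
  by rewrite lerBlDr natr1 ltW // truncnS_gt.
have m0N : 2 * e * N%:R + m0%:R <= N%:R.
  have : N%:R * p <= N%:R by rewrite ler_piMr // ltW.
  by nra.
have m0Nn : (m0 <= N)%N.
  by rewrite -(ler_nat R); apply: le_trans m0N; rewrite lerDr mulr_ge0 ?mulr_ge0 // ltW.
pose L := (Num.trunc (eta * n%:R / 2)).+1.
have etan0 : 0 <= eta * n%:R / 2 by rewrite divr_ge0 // mulr_ge0 // ltW.
have Lge : eta * n%:R / 2 <= L%:R by rewrite ltW // truncnS_gt.
have Lle : L%:R <= eta * n%:R / 2 + 1 by rewrite /L -natr1 lerD2r truncn_le.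
pose c := (m0 %/ (K * L))%N.
have cm0 : (c * (K * L) <= m0)%N by exact: leq_trunc_div.
have KL0 : (0 < K * L)%N by rewrite muln_gt0 K0.
have m0c : m0%:R <= (c%:R + 1) * (K%:R * L%:R) :> R.
  by rewrite natr1 -!natrM ler_nat ltnW // ltn_ceil.
have level : (1 - 6 * e) * expR 1 * (n%:R * p) <= c%:R * l%:R.
  apply: (chunk_count_estimate (m := m0%:R) (L := L%:R) (K := K%:R) (eta := eta)) => //.
  - by rewrite lE xE; ring.
  - by rewrite -NE.
  by rewrite [leRHS]mulrC -ler_pdivrMr // mulr_gt0 // expR_gt0.
have event E (f : {ffun edge E -> 'I_#|E|}) : (c * l <= longest_increasing_trail f)%N ->
    (1 - eps) * expR 1 * n%:R * p <= (@longest_increasing_trail n E f)%:R.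
  rewrite -(ler_nat R) natrM; apply: le_trans; apply: le_trans level.
  rewrite -mulrA -[leLHS]mulrA -[leRHS]mulrA ler_wpM2r ?mulr_ge0 ?expR_ge0 //; lra.
apply: le_trans (gnp_tips_ge p01 chernoff m0le event).
have M_eq : b * n%:R * (2 ^ K)%:R = e / 16 * n%:R.
  by rewrite /b; field; rewrite gt_eqF.
have nM : 2 * (e / 16 * n%:R) + 1 <= n%:R.
  have : e * n%:R <= 4^-1 * n%:R by rewrite ler_wpM2r // ltW.
  by lra.
have bn0 : 0 < b * n%:R by rewrite mulr_gt0.
have bnn : b * n%:R <= n%:R by rewrite ler_piMl // ltW.
have gain T : b * n%:R * x ^+ l <= T ->
    e / 4 * (x * T) - L%:R * ((T * (n%:R - 2 * (e / 16 * n%:R) - 1) / N%:R - d)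
      * (e / 4 - (e / 4) ^+ 2)) <= - (lam * n%:R).
  rewrite mulrAC -/mu => muT; rewrite xE.
  apply: gain_estimate => //; last exact: ltW.
  rewrite NE; have : 0 <= n%:R :> R by [].
  by rewrite expr2; lra.
(* th = D^2 d / (2 N) minimizes Azuma's exponent for m = N. *)
have whp := tips_whp (ltW bn0) (ltW x0) x1 zb nM gain (K := K) (c := c) (m := m0)
  (th := 2 * e ^+ 2 * d * N%:R) (D := 2 * e * N%:R).
clear gain; clearbody c L m0 lam d mu b eta.
have D0 : 0 < 2 * e * N%:R by rewrite !mulr_gt0.
have th0 : 0 <= 2 * e ^+ 2 * d * N%:R by rewrite !mulr_ge0 ?exprn_ge0 // ltW.
have thD : 3 * (2 * e ^+ 2 * d * N%:R) <= 2 * e * N%:R.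
  have ed : 3 * (e * d) <= 1.
    by rewrite mulrA mulr_ile1 ?mulr_ge0 ?(ltW e0) ?(ltW d0) //; case/andP: chernoff => _; lra.
  have -> : 3 * (2 * e ^+ 2 * d * N%:R) = 2 * e * N%:R * (3 * (e * d)) by ring.
  by rewrite ler_piMr // ltW.
have {}whp := whp bn0 _ bnn Kl (ltW d0) th0 thD D0 m0N cm0.
rewrite M_eq lexx in whp; have {}whp := whp isT.
have fail1 : c%:R * (K%:R * (l%:R * expR (- (lam * n%:R)))) <= tau / 3.
  have cN : c%:R <= n%:R ^+ 2 :> R.
    apply: (@le_trans _ _ N%:R).
      rewrite ler_nat; apply: leq_trans m0Nn; apply: leq_trans cm0.
      by rewrite leq_pmulr.
    rewrite NE; have : 0 <= n%:R * (n%:R + 1) :> R by rewrite mulr_ge0 // addr_ge0.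
    by rewrite expr2; lra.
  exact: block_error_le.
have fail2 : m0%:R * (4 ^ n)%:R * expR (m0%:R * ((2 * e ^+ 2 * d * N%:R) ^+ 2 /
     (2 * e * N%:R) ^+ 2) - 2 * e ^+ 2 * d * N%:R * d) <= tau / 3.
  apply: le_trans (exp_decay_vs_4n e0 d0 n2 nt4 m0Nn) _.
  move: nt5; rewrite ler_pdivrMr // => nt5'.
  rewrite ler_pdivrMr // mulrAC ler_pdivlMr // [leRHS]mulrC.
  by have -> : 6 * 3 = 18 :> R by ring.
have fail3 : expR (- (e ^+ 2 * (N%:R * p))) <= tau / 3.
  by rewrite NE; exact: tail_error_le.
apply: le_trans (lerB whp fail3); rewrite -addrA -opprD lerD2l lerN2.
apply: le_trans (lerD (lerD fail1 fail2) (lexx _)) _.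
by rewrite le_eqVlt; apply/orP; left; apply/eqP; field.
Qed.

End MainTheorem.

Local Open Scope classical_set_scope.

Theorem theorem1p1 (R : realType) (eps : R) (p : nat -> R)
    (eps_gt0 : 0 < eps)
    (p01 : forall n : nat, 0 <= p n <= 1)
    (p_omega : (fun n : nat => ln n%:R / n%:R : R^o) =o_\oo (p : nat -> R^o)) :
  (fun n : nat => gnp_ordering_prob (p n)
     (fun (E : {set {set 'I_n}}) (f : {ffun edge E -> 'I_#|E|}) =>
        (1 - eps) * expR 1 * n%:R * p n <= (longest_increasing_trail f)%:R))
    @ \oo --> (1 : R).
Proof.
apply/cvgrPdist_le => tau tau0.
have [y0 prob_ge] := increasing_trail_prob_ge eps_gt0 tau0.
(* The growth hypothesis is used with this constant: as ln n >= 1 once n >= [expR 1], it gives n p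
   >= |y0| + 1. *)
have c0 : 0 < (`|y0| + 1)^-1 by rewrite invr_gt0 ltr_wpDl.
move/eqoP : p_omega => /(_ _ c0) small.
near=> n.
have /andP[pn0 pn1] := p01 n.
rewrite ger0_norm ?subr_ge0 ?gnp_ordering_prob_le1 // lerBlDl -lerBlDr.
have n_e : expR 1 <= n%:R :> R by near: n; exact: nbhs_infty_ger.
have n0 : 0 < n%:R :> R by apply: lt_le_trans n_e; exact: expR_gt0.
apply: prob_ge => //; first by near: n; exact: nbhs_infty_ger.
have ln1 : 1 <= ln n%:R :> R by rewrite -[leLHS](expRK 1) ler_ln ?posrE ?expR_gt0.
have : `|ln n%:R / n%:R : R| <= (`|y0| + 1)^-1 * `|p n| by near: n.
have lnn0 : 0 <= ln n%:R / n%:R :> R by rewrite divr_ge0 // (le_trans ler01).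
rewrite (ger0_norm lnn0) (ger0_norm pn0) ler_pdivrMr // -mulrA.
rewrite ler_pdivlMl ?ltr_wpDl // => h.
apply: le_trans (ler_norm _) _; apply: (@le_trans _ _ (`|y0| + 1)).
  by rewrite lerDl.
rewrite mulrC; apply: le_trans h; rewrite ler_peMr // ltW // ltr_wpDl //.
Unshelve. all: by end_near.
Qed.
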